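(* Let $n$ and $k$ be non-negative integers with $k\le\frac{n+1}{2}$. For the exploded diagonal triangulation $\mathcal{T}_{n,k}=(T_{n,k},\emptyset)$ we have $$\deg(\mathcal{T}_{n,k})\ge 2^{k-1}(2n-k).$$
   Context: $T_{n,k}$ is the simplicial complex (homeomorphic to a disk) with $n+k+4$ vertices: four corners $P=p_0$, $Q$, $R=p_{n+1}$, $S$ in cyclic order, and interior vertices $p_1,\dots,p_n$ and $p_1',p_3',\dots,p_{2k-1}'$. Its $2n+2k+2$ triangles have vertex sets: $\{S,p_i,p_{i+1}\}$ for $i=0,\dots,n$; $\{Q,p_{2i-1}',p_{2i-2}\}$ for $i=1,\dots,k$; $\{Q,p_{2i},p_{2i-1}'\}$ for $i=1,\dots,k$; $\{Q,p_{i+1},p_i\}$ for $i=2k,\dots,n$; $\{p_{2i-2},p_{2i-1}',p_{2i-1}\}$ for $i=1,\dots,k$; $\{p_{2i},p_{2i-1},p_{2i-1}'\}$ for $i=1,\dots,k$. The notation $(T_{n,k},\emptyset)$ means that no collinearity condition is imposed. Degree: for a simplicial complex $T$ homeomorphic to a disk, oriented, with exactly four boundary vertices $P_1,\dots,P_4$ in cyclic order, let $(z_1,z_2,z_3,z_4)$ be the vertices, in cyclic order, of a nondegenerate parallelogram. Let $X$ be the set of maps $\rho:\mathrm{Vert}(T)\to\mathbb{C}^2$ for which there is a (not necessarily invertible) affine map $\phi$ of $\mathbb{C}^2$ with $\rho(P_i)=\phi(z_i)$ for all $i$. Let $Y$ be the complex projective space with one homogeneous coordinate for each triangle of $T$,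 and let $V\subset Y$ be the Zariski closure of the image of the rational map $X\dashrightarrow Y$ sending $\rho$ to the tuple of signed areas of the image triangles (the area of an oriented triangle with vertices $(x_i,y_i)$, $i=1,2,3$, is half the determinant with rows $(1,1,1),(x_1,x_2,x_3),(y_1,y_2,y_3)$). $V$ is an irreducible hypersurface; the Monsky polynomial $p(\mathcal{T})$ of $\mathcal{T}=(T,\emptyset)$ is the irreducible homogeneous polynomial vanishing on it, scaled to have integer coefficients with no common factor, and $\deg(\mathcal{T})=\deg p(\mathcal{T})$. *)

(* Defs.v *)
From HB Require Import structures.
From mathcomp Require Import all_boot all_order all_algebra.
From mathcomp Require Import reals complex.
From mathcomp Require Import mpoly.

Set Implicit Arguments.
Unset Strict Implicit.
Unset Printing Implicit Defensive.

Import GRing.Theory.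
Local Open Scope ring_scope.

(* The part of an oriented triangulated quadrilateral that enters the
   definition of its degree.  Each triangle is listed as an oriented triple of
   vertices, the orientations being coherent; [corners] lists the four
   boundary vertices in cyclic order. *)
Record quad_complex := QuadComplex {
  vert : finType;
  triangles : seq (3.-tuple vert);
  corners : 4.-tuple vert
}.

Section Monsky.

Variable R : realType.
Local Notation C := R[i].
Local Notation point := 'cV[C]_2.

(* The arguments [1], [2], [3] of [tnth] are elements of ['I_4]. *)
Definition nondegenerate_parallelogram (z : 4.-tuple point) : Prop :=
  tnth z 1 - tnth z 0 = tnth z 2 - tnth z 3 /\
  \det (row_mx (tnth z 1 - tnth z 0) (tnth z 3 - tnth z 0) : 'M_(2, 1 + 1)) != 0.

Definition signed_area (a b c : point) : C :=
  \det (\matrix_(i < 3, j < 3)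
          let v := tnth [tuple a; b; c] j in
          tnth [tuple 1; v 0 0; v 1 0] i) / 2.

(* A point of projective space is represented by any of its nonzero vectors of
   homogeneous coordinates, and a set of points by a set of such vectors. *)
Definition proj_point N (x : 'I_N -> C) : Prop := exists i, x i != 0.

Definition zariski_closure N (S : ('I_N -> C) -> Prop) (y : 'I_N -> C) : Prop :=
  proj_point y /\
  forall (d : nat) (f : {mpoly C[N]}), f \is d.-homog ->
    (forall x, S x -> f.@[x] = 0) -> f.@[y] = 0.

Section Degree.

Variables (T : quad_complex) (z : 4.-tuple point).
Local Notation N := (size (triangles T)).

Definition area_vector (rho : vert T -> point) (t : 'I_N) : C :=
  let tri := tnth (in_tuple (triangles T)) t in
  signed_area (rho (tnth tri 0)) (rho (tnth tri 1)) (rho (tnth tri 2)).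

Definition drawing (rho : vert T -> point) : Prop :=
  exists (A : 'M[C]_2) (b : point),
    forall i, rho (tnth (corners T) i) = A *m tnth z i + b.

(* The rational map is defined where the area vector is nonzero. *)
Definition area_image (x : 'I_N -> C) : Prop :=
  proj_point x /\ exists2 rho, drawing rho & x = area_vector rho.

Definition area_variety : ('I_N -> C) -> Prop := zariski_closure area_image.

End Degree.

Definition irreducible_mpoly N (f : {mpoly C[N]}) : Prop :=
  [/\ f != 0, f \isn't a GRing.unit
    & forall g h, f = g * h -> g \is a GRing.unit \/ h \is a GRing.unit].

Definition coprime_coeffs N (p : {mpoly int[N]}) : Prop :=
  forall d : int, (forall m, (d %| p@_m)%Z) -> d \is a GRing.unit.

(* Irreducibility is over the complex numbers.  These conditions determine [p]
   up to sign when [area_variety T z] is an irreducible hypersurface, as it is for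
   a coherently oriented triangulated disk and a nondegenerate parallelogram. *)
Definition monsky_polynomial (T : quad_complex) (z : 4.-tuple point)
    (p : {mpoly int[size (triangles T)]}) : Prop :=
  let pC : {mpoly C[_]} := map_mpoly intr p in
  [/\ coprime_coeffs p,
      exists d : nat, p \is d.-homog,
      irreducible_mpoly pC
    & forall y, area_variety z y -> pC.@[y] = 0].

End Monsky.

Definition total_degree (A : nzRingType) N (p : {mpoly A[N]}) : nat :=
  (msize p).-1.

(* [vp i] is p_i, with P = p_0 and R = p_(n+1); [vp' i] is p'_(2i+1). *)
Inductive ed_vertex (n k : nat) : Type :=
  | vQ
  | vS
  | vp of 'I_n.+2
  | vp' of 'I_k.
Arguments vQ {n k}.
Arguments vS {n k}.
Arguments vp {n k} _.
Arguments vp' {n k} _.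

Section EdVertexFinite.
Variables n k : nat.

Definition ed_encode (v : ed_vertex n k) : bool + ('I_n.+2 + 'I_k) :=
  match v with
  | vQ => inl true
  | vS => inl false
  | vp i => inr (inl i)
  | vp' i => inr (inr i)
  end.

Definition ed_decode (c : bool + ('I_n.+2 + 'I_k)) : ed_vertex n k :=
  match c with
  | inl b => if b then vQ else vS
  | inr (inl i) => vp i
  | inr (inr i) => vp' i
  end.

Lemma ed_encodeK : cancel ed_encode ed_decode.
Proof. by case. Qed.

HB.instance Definition _ := Finite.copy (ed_vertex n k) (can_type ed_encodeK).

End EdVertexFinite.

Section ExplodedDiagonal.

Variables n k : nat.

(* Used only for [i <= n.+1], where [inord i] has value [i]. *)
Local Notation p_ i := (@vp n k (inord i)).
Local Notation tri a b c := [tuple (a : ed_vertex n k); b; c].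

(* For [i : 'I_k], the vertex [vp' i] lies between [p_ (2i)], [p_ (2i+1)] and
   [p_ (2i+2)].  The triples are coherently oriented, compatibly with the
   boundary cycle P, Q, R, S. *)
Definition ed_triangles : seq (3.-tuple (ed_vertex n k)) :=
  [seq tri vS (p_ i) (p_ i.+1) | i <- iota 0 n.+1]
  ++ [seq tri vQ (vp' i) (p_ i.*2) | i : 'I_k <- enum 'I_k]
  ++ [seq tri vQ (p_ i.*2.+2) (vp' i) | i : 'I_k <- enum 'I_k]
  ++ [seq tri vQ (p_ i.+1) (p_ i) | i <- index_iota k.*2 n.+1]
  ++ [seq tri (p_ i.*2) (vp' i) (p_ i.*2.+1) | i : 'I_k <- enum 'I_k]
  ++ [seq tri (p_ i.*2.+2) (p_ i.*2.+1) (vp' i) | i : 'I_k <- enum 'I_k].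

Definition exploded_diagonal : quad_complex :=
  @QuadComplex (ed_vertex n k) ed_triangles
    [tuple vp ord0; vQ; vp ord_max; vS].

End ExplodedDiagonal.

(* Main.v *)
Require Import Defs.
From HB Require Import structures.
From mathcomp Require Import all_boot all_order all_algebra.
From mathcomp Require Import reals complex.
From mathcomp Require boolp.
From mathcomp Require Import mpoly ring zify.

(* The bound holds for the degree of every nonzero polynomial vanishing on the
   area vectors, provided n > k. Put S at the origin and set to zero, one after
   the other, the areas of the triangles S p_(2i) p_(2i+1) and
   p_(2i) p'_(2i+1) p_(2i+1), i < k. Dividing the polynomial beforehand by the
   largest possible power of the variable keeps its restriction nonzero, and the
   restriction still vanishes on the degenerate drawings, because the drawings
   before each step form irreducible families. In a degenerate drawing p_(2i+1)
   is on the line S p_(2i), and either p_(2i+1) = p_(2i) or p'_(2i+1) is on that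
   line too; this gives 2^k components. Let v_j be the heights over the diagonal
   SQ of the vertices p_0, p_2, .., p_(2k), p_(2k+1), .., p_(n+1), so that
   v_0 = - h and v_(n+1-k) = h. A component is given by 1 + h sum_j x_j = 0, with
   x_j = a_j / (v_j v_(j+1)) or, in the second case,
   x_j = (v_(j+1) - b_j) / (w_j v_(j+1)), in linear coordinates a, b, v, w. On a
   generic plane with coordinates (tau, y), where tau moves the v_j and w_j and y
   moves the last a and b, it becomes the graph of a rational function
   y = N / D, where D is a product of n - k - 1 + m distinct linear factors and
   m is the number of indices of the second kind. The restricted polynomial is
   then divisible by the product of the coprime factors D y - N, and the sum of
   their degrees 1 + deg D over all components is 2^(k-1) (2n - k). *)

Set Implicit Arguments.
Unset Strict Implicit.
Unset Printing Implicit Defensive.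

Import Order.TTheory GRing.Theory Num.Theory.
Local Open Scope ring_scope.

(** * Restricting polynomials to coordinate hyperplanes *)

Lemma poly_nonroot (F : numFieldType) (p : {poly F}) :
  p != 0 -> exists t, p.[t] != 0.
Proof.
move=> pn0; suff /allPn [t _ pt] :
    ~~ all (root p) [seq i%:R : F | i <- iota 0 (size p)] by exists t.
apply/negP => pr.
suff : (size [seq i%:R : F | i <- iota 0 (size p)] < size p)%N.
  by rewrite size_map size_iota ltnn.
apply: max_poly_roots => //.
rewrite map_inj_uniq ?iota_uniq // => i j /eqP.
by rewrite eqr_nat => /eqP.
Qed.

Lemma poly_eq0_by_values (F : numFieldType) (p : {poly F}) :
  (forall t, p.[t] = 0) -> p = 0.
Proof.
move=> p0; apply/eqP/negPn/negP => /poly_nonroot [t].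
by rewrite p0 eqxx.
Qed.

Lemma rmorph_mmap N (A B C : comNzRingType) (phi : {rmorphism B -> C})
    (f : A -> B) (f' : A -> C) (g : 'I_N -> B) (g' : 'I_N -> C)
    (p : {mpoly A[N]}) :
    (forall a, phi (f a) = f' a) -> (forall i, phi (g i) = g' i) ->
  phi (mmap f g p) = mmap f' g' p.
Proof.
move=> ff' gg'; rewrite /mmap rmorph_sum; apply: eq_bigr => m _.
rewrite rmorphM ff' /mmap1 rmorph_prod; congr (_ * _).
by apply: eq_bigr => i _; rewrite rmorphXn gg'.
Qed.

(** The exponent [e] is the least one of ['X_i] in [r]; [r'] collects the monomials attaining it,
    with that power removed, and [s] comes from the others. Variables in [J], eliminated earlier,
    stay absent. *)
Lemma lowest_part (F : fieldType) N (r : {mpoly F[N]}) (i : 'I_N)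
    (J : pred 'I_N) :
    r != 0 -> (forall m j, m \in msupp r -> J j -> m j = 0%N) ->
  exists r', [/\ r' != 0, (msize r' <= msize r)%N,
    forall m j, m \in msupp r' -> J j || (j == i) -> m j = 0%N
    & exists e s, r = 'X_i ^+ e * (r' + 'X_i * s)].
Proof.
move=> r0 rJ.
have exm : exists e, has (fun m : 'X_{1..N} => m i == e) (msupp r).
  case E: (msupp r) => [|m l]; first by move: r0; rewrite -msupp_eq0 E.
  by exists (m i); rewrite /= eqxx.
pose e := ex_minn exm.
have emin m : m \in msupp r -> (e <= m i)%N.
  rewrite /e; case: ex_minnP => e0 _ + mr; apply.
  by apply/hasP; exists m.
have [m0 m0r m0e] : exists2 m, m \in msupp r & m i = e.
  rewrite /e; case: ex_minnP => e0 /hasP [m mr /eqP mi] _.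
  by exists m.
pose U d (m : 'X_{1..N}) := (m - U_(i) *+ d)%MM.
pose r' := \sum_(m <- msupp r | m i == e) r@_m *: 'X_[U e m].
pose s := \sum_(m <- msupp r | m i != e) r@_m *: 'X_[U e.+1 m].
have UE d (m : 'X_{1..N}) : (d <= m i)%N -> (U d m + U_(i) *+ d)%MM = m.
  move=> dm; apply: submK; apply/mnm_lepP => j.
  by rewrite mulmnE mnm1E; case: eqVneq => [<-|_]; rewrite ?mul1n ?mul0n.
have rE : r = 'X_i ^+ e * (r' + 'X_i * s).
  rewrite [LHS]mpolyE (bigID (fun m : 'X_{1..N} => m i == e)) /= mulrDr.
  rewrite mulrA -exprSr /r' /s !mulr_sumr big_seq_cond [in RHS]big_seq_cond.
  congr (_ + _).
    apply: eq_bigr => m /andP [mr /eqP me].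
    by rewrite -scalerAr mpolyXn -mpolyXD addmC UE ?me.
  rewrite big_seq_cond [in RHS]big_seq_cond; apply: eq_bigr => m /andP [mr me].
  rewrite -scalerAr mpolyXn -mpolyXD addmC UE //.
  by rewrite ltn_neqAle eq_sym me emin.
have r'c m : m \in msupp r' -> exists2 m1, m1 \in msupp r & m1 i = e /\ m = U e m1.
  move=> /msupp_sum_le /flattenP [l /mapP [m1]].
  rewrite mem_filter => /andP [/eqP m1e m1r] ->.
  move=> /msuppZ_le; rewrite msuppX inE => /eqP ->.
  by exists m1.
exists r'; split.
(* Lowering by [e] is injective on the monomials of exponent [e], so only [m0] contributes to this
   coefficient. *)
- apply/eqP => /(congr1 (mcoeff (U e m0))).
  rewrite mcoeff0 /r' raddf_sum /= -big_filter.
  rewrite (bigD1_seq m0) ?filter_uniq ?msupp_uniq ?mem_filter ?m0e ?eqxx //=.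
  rewrite big1_seq ?addr0; last first.
    move=> m /andP [mm0]; rewrite mem_filter => /andP [/eqP me mr].
    rewrite mcoeffZ mcoeffX; case: eqP => [E|_]; last by rewrite mulr0.
    by case/eqP: mm0; rewrite -(UE e m) ?me // E UE ?m0e.
  rewrite mcoeffZ mcoeffX eqxx mulr1; apply/eqP.
  by rewrite -mcoeff_msupp.
- rewrite msizeE; apply/bigmax_leqP_seq.
  move=> m /r'c [m1 m1r [m1e ->]] _; apply: leq_ltn_trans (msize_mdeg_lt m1r).
  by rewrite -{2}(UE e m1) ?m1e // mdegD leq_addr.
- move=> m j /r'c [m1 m1r [m1e ->]] /orP [Jj|/eqP ->].
    by rewrite mnmBE (rJ m1 j).
  by rewrite mnmBE mulmnE mnm1E eqxx mul1n m1e subnn.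
- by exists e, s.
Qed.

Lemma meval_indep (F : fieldType) N (r : {mpoly F[N]}) (J : pred 'I_N) x x' :
    (forall m j, m \in msupp r -> J j -> m j = 0%N) ->
    (forall j, ~~ J j -> x j = x' j) ->
  r.@[x] = r.@[x'].
Proof.
move=> rJ xx'; rewrite !mevalE !big_seq; apply: eq_bigr => m mr.
congr (_ * _); apply: eq_bigr => j _.
by case: (boolP (J j)) => [Jj|/xx' -> //]; rewrite (rJ m j).
Qed.

(** One variable is eliminated at a time, [J] being the set of those already absent. A point where
    the lowest part in ['X_i] is nonzero is moved off the hyperplane x_i = 0. *)
Lemma mpoly_nonroot (F : numFieldType) N (r : {mpoly F[N]}) :
  r != 0 -> exists x, r.@[x] != 0.
Proof.
move=> r0; have [l] := ubnP (N - #|(set0 : {set 'I_N})|).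
have rJ m j : m \in msupp r -> j \in (set0 : {set 'I_N}) -> m j = 0%N.
  by rewrite inE.
elim: l set0 r r0 rJ => // l IH J r r0 rJ Jl.
case: (pickP (fun i => i \notin J)) => [i iJ|JT]; last first.
  exists (fun=> 0); rewrite mevalE.
  have m0 m : m \in msupp r -> m = 0%MM.
    by move=> mr; apply/mnmP => i; rewrite mnm0E (rJ m i) //; have /negbFE := JT i.
  case E: (msupp r) => [|m L]; first by move: r0; rewrite -msupp_eq0 E.
  have mE : m = 0%MM by apply: m0; rewrite E mem_head.
  have L0 : L = [::].
    have := msupp_uniq r; rewrite E mE; case: L E => //= m' L E.
    by rewrite (m0 m') ?E ?inE ?eqxx ?orbT.
  rewrite L0 big_seq1 mulf_neq0 //; first by rewrite -mcoeff_msupp E mem_head.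
  by apply/prodf_neq0 => i _; rewrite mE mnm0E expr0 oner_neq0.
have [r' [r'0 _ r'J [e [s rE]]]] := lowest_part i r0 rJ.
have [||x r'x] := IH (i |: J) r' r'0; first by move=> m j mr; rewrite !inE orbC; apply: r'J.
  by rewrite cardsU1 iJ; move: Jl (max_card (mem (i |: J))); rewrite cardsU1 iJ card_ord; lia.
pose g j : {poly F} := if j == i then 'X else (x j)%:P.
pose P' : {poly F} := mmap polyC g (r' + 'X_i * s).
have P'E t : P'.[t] = (r' + 'X_i * s).@[fun j => if j == i then t else x j].
  apply: (@rmorph_mmap _ _ _ _ (horner_eval t)) => [a|j]; first exact: hornerC.
  by rewrite /g /= /horner_eval; case: ifP; rewrite ?hornerX ?hornerC.
have P'0 : P' != 0.
  suff : P'.[0] != 0 by apply: contraNneq => ->; rewrite horner0.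
  rewrite P'E mevalD mevalM mevalXU eqxx mul0r addr0.
  rewrite (@meval_indep _ _ r' (fun j => (j \in J) || (j == i)) _ x) // => j.
  by rewrite negb_or => /andP [_ /negPf ->].
(* The factor ['X] forces [t != 0], so that the power of ['X_i] divided out is nonzero too. *)
have /poly_nonroot [t] : 'X * P' != 0 by rewrite mulf_neq0 ?polyX_eq0.
rewrite hornerM hornerX mulf_eq0 negb_or P'E => /andP [t0 rt].
exists (fun j => if j == i then t else x j).
by rewrite rE mevalM rmorphXn /= mevalXU eqxx mulf_neq0 ?expf_neq0.
Qed.

Definition vanishes_on (F : fieldType) N (r : {mpoly F[N]})
  (Z : ('I_N -> F) -> Prop) := forall x, Z x -> r.@[x] = 0.

(* A polynomial curve inside [Z] through a point of [Z] and leaving the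
   hyperplane [x i = 0] replaces the irreducibility of [Z]. *)
Lemma restrict_hyperplane (F : numFieldType) N (r : {mpoly F[N]}) (i : 'I_N)
    (J : pred 'I_N) :
    r != 0 -> (forall m j, m \in msupp r -> J j -> m j = 0%N) ->
  exists r', [/\ r' != 0, (msize r' <= msize r)%N,
    forall m j, m \in msupp r' -> J j || (j == i) -> m j = 0%N
    & forall Z : ('I_N -> F) -> Prop, vanishes_on r Z ->
        (forall x, Z x -> exists g : 'I_N -> {poly F},
          [/\ forall t, Z (fun j => (g j).[t]), forall j, (g j).[0] = x j
            & g i != 0]) ->
      vanishes_on r' (fun x => Z x /\ x i = 0)].
Proof.
move=> r0 rJ; have [r' [r'0 szr' r'J [e [s rE]]]] := lowest_part i r0 rJ.
exists r'; split=> // Z rZ curve x [Zx xi0].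
have [g [Zg g0 gi]] := curve x Zx.
pose q := r' + 'X_i * s.
pose Q : {poly F} := mmap polyC g q.
have QE t : Q.[t] = q.@[fun j => (g j).[t]].
  by apply: (@rmorph_mmap _ _ _ _ (horner_eval t)) => // a; apply: hornerC.
(* Along the curve [r] is [g i ^+ e * Q] with [g i] a nonzero polynomial, so [Q] vanishes, in
   particular at 0, where the curve passes through [x]. *)
have Q0 : Q = 0.
  have : g i ^+ e * Q = 0.
    have : forall t, (g i ^+ e * Q).[t] = 0.
      move=> t; rewrite hornerM horner_exp QE.
      by have := rZ _ (Zg t); rewrite rE mevalM rmorphXn /= mevalXU.
    exact: poly_eq0_by_values.
  by move/eqP; rewrite mulf_eq0 expf_eq0 (negPf gi) andbF => /eqP.
have := QE 0; rewrite Q0 horner0 (meval_eq _ g0).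
by rewrite mevalD mevalM mevalXU xi0 mul0r addr0.
Qed.

(** * Rational roots of bivariate polynomials *)

Section Bidegree.
Variable F : numFieldType.
Implicit Types (f g : {poly {poly F}}) (N D B : {poly F}).

(* The truncated subtraction makes coefficients of index above [d] vanish. *)
Definition bidegree_le d f := forall l, (size (f`_l)%R <= d.+1 - l)%N.

Lemma bidegree_leW d e f : (d <= e)%N -> bidegree_le d f -> bidegree_le e f.
Proof. by move=> de fd l; apply: leq_trans (fd l) _; apply: leq_sub2r. Qed.

Lemma bidegree_leC D : (size D <= 1)%N -> bidegree_le 0 D%:P.
Proof. by move=> sD [|l]; rewrite coefC ?size_poly0. Qed.

Lemma bidegree_leD d f g :
  bidegree_le d f -> bidegree_le d g -> bidegree_le d (f + g).
Proof.
move=> fd gd l; rewrite coefD (leq_trans (size_polyD _ _)) //.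
by rewrite geq_max fd gd.
Qed.

Lemma bidegree_leM d e f g :
  bidegree_le d f -> bidegree_le e g -> bidegree_le (d + e) (f * g).
Proof.
move=> fd ge l; rewrite coefM (leq_trans (size_sum _ _ _)) //.
apply/bigmax_leqP => j _; have := fd j; have := ge (l - j)%N.
case: (eqVneq f`_j 0) => [->|f0]; first by rewrite mul0r size_poly0.
case: (eqVneq g`_(l - j) 0) => [->|g0]; first by rewrite mulr0 size_poly0.
rewrite size_mul //; move: f0 g0 (ltn_ord j); rewrite -!size_poly_gt0.
have H (a b j' : nat) : (0 < a -> 0 < b -> j' < l.+1 -> b <= e.+1 - (l - j') ->
  a <= d.+1 - j' -> (a + b).-1 <= (d + e).+1 - l)%N by lia.
exact: H.
Qed.

Lemma bidegree_le_mmap M (r : {mpoly F[M]}) (g : 'I_M -> {poly {poly F}}) :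
    (forall i, bidegree_le 1 (g i)) ->
  bidegree_le (msize r).-1 (mmap (polyC \o polyC) g r).
Proof.
move=> g1; rewrite /mmap big_seq.
apply: (big_ind (bidegree_le (msize r).-1)) => [||m mr].
- by move=> l; rewrite coef0 size_poly0.
- exact: bidegree_leD.
apply: (@bidegree_leW (0 + mdeg m)).
  by have := msize_mdeg_lt mr; case: (msize r).
apply: bidegree_leM; first by apply: bidegree_leC; rewrite size_polyC leq_b1.
have bX i e : bidegree_le e (g i ^+ e).
  elim: e => [|e IH]; first by apply: bidegree_leC; rewrite size_poly1.
  by rewrite exprS -add1n; apply: bidegree_leM.
rewrite mdegE /mmap1; elim/big_rec2: _ => [|i d f _ IH].
  by apply: bidegree_leC; rewrite size_poly1.
exact: bidegree_leM.
Qed.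

Definition eval2 f t y := (map_poly (horner_eval t) f).[y].

(** Expresses through values that N / D is a root of [f] over the field of rational functions; [B]
    cuts out finitely many exceptional parameters. *)
Definition generic_root f N D := exists2 B, B != 0 &
  forall t, B.[t] != 0 -> D.[t] != 0 -> eval2 f t (N.[t] / D.[t]) = 0.

Lemma eval2D f g t y : eval2 (f + g) t y = eval2 f t y + eval2 g t y.
Proof. by rewrite /eval2 rmorphD hornerD. Qed.

Lemma eval2M f g t y : eval2 (f * g) t y = eval2 f t y * eval2 g t y.
Proof. by rewrite /eval2 rmorphM hornerM. Qed.

Lemma eval2C D t y : eval2 D%:P t y = D.[t].
Proof. by rewrite /eval2 map_polyC hornerC. Qed.

Lemma eval2X t y : eval2 'X t y = y.
Proof. by rewrite /eval2 map_polyX hornerX. Qed.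

Definition linear_factor N D : {poly {poly F}} := D%:P * 'X - N%:P.

Lemma eval2_linear_factor N D t y :
  eval2 (linear_factor N D) t y = D.[t] * y - N.[t].
Proof. by rewrite /linear_factor -polyCN eval2D eval2M !eval2C eval2X hornerN. Qed.

(** At y = N' / D' the linear factor is (N' D - N D') / D', whose numerator joins the exceptional
    polynomial. *)
Lemma generic_rootM g N D N' D' : D != 0 -> D' != 0 -> N' * D != N * D' ->
  generic_root (linear_factor N D * g) N' D' -> generic_root g N' D'.
Proof.
move=> D0 D'0 ND [B B0 HB].
exists (B * (N' * D - N * D')); first by rewrite mulf_neq0 // subr_eq0.
move=> t; rewrite hornerM mulf_eq0 negb_or => /andP [Bt NDt] D't.
have := HB t Bt D't; rewrite eval2M eval2_linear_factor => /eqP.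
rewrite mulf_eq0 => /orP [|/eqP //]; move: NDt.
rewrite hornerD hornerN !hornerM.
have -> : D.[t] * (N'.[t] / D'.[t]) - N.[t] =
    (N'.[t] * D.[t] - N.[t] * D'.[t]) / D'.[t] by field.
by rewrite mulf_eq0 invr_eq0 (negPf D't) orbF => /negPf ->.
Qed.

(** By coprimality, [D] divides the leading coefficient of [f] in y, so division by the linear
    factor needs no denominators. *)
Lemma generic_root_factor f N D : coprimep N D -> D != 0 ->
  generic_root f N D -> exists g, f = linear_factor N D * g.
Proof.
move=> coND D0; have [n sf] := ubnP (size f); elim: n f sf => // n IH f sf fND.
case: n => [|n] in IH sf.
  by exists 0; rewrite mulr0; apply/eqP; rewrite -size_poly_eq0 -leqn0.
have [B B0 HB] := fND.
(* This is the value of [f] at y = N / D, multiplied by D^n. *)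
pose H := \sum_(l < n.+1) f`_l * N ^+ l * D ^+ (n - l).
have H0 : H = 0.
  suff : B * D * H = 0.
    by move/eqP; rewrite !mulf_eq0 (negPf B0) (negPf D0) => /eqP.
  apply: poly_eq0_by_values => t; rewrite !hornerM.
  case: (eqVneq B.[t] 0) => [->|Bt]; first by rewrite !mul0r.
  case: (eqVneq D.[t] 0) => [->|Dt]; first by rewrite mulr0 mul0r.
  have := HB t Bt Dt; rewrite /eval2 (@horner_coef_wide _ n.+1); last first.
    by rewrite (leq_trans (size_poly _ _)).
  move=> E; have -> : H.[t] = D.[t] ^+ n * 0; last by rewrite !mulr0.
  rewrite -E /H mulr_sumr -horner_evalE raddf_sum; apply: eq_bigr => l _.
  rewrite coef_map /= !horner_evalE !hornerM !horner_exp expr_div_n.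
  have -> : D.[t] ^+ n = D.[t] ^+ (n - l) * D.[t] ^+ l.
    by rewrite -exprD subnK // -ltnS.
  by field; rewrite expf_neq0.
have DN : D %| f`_n * N ^+ n.
  move: H0; rewrite /H big_ord_recr /= subnn expr0 mulr1 addrC => /eqP.
  rewrite addr_eq0 => /eqP ->; rewrite dvdpNr; apply: (big_ind (fun x => D %| x)) => [||l _].
  - exact: dvdp0.
  - by move=> x y; apply: dvdp_add.
  by rewrite dvdp_mull // dvdp_exp // subn_gt0.
have {DN} : D %| f`_n by rewrite Gauss_dvdpl in DN; last by rewrite coprimep_expr // coprimep_sym.
case: n => [|n] in IH sf H H0 *.
  move=> _; exists 0; rewrite mulr0 [f]size1_polyC //.
  by move: H0; rewrite /H big_ord1 !expr0 !mulr1 => ->.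
move/dvdpP => [c fc].
pose f1 := f - linear_factor N D * (c%:P * 'X^n).
have sf1 : (size f1 < n.+2)%N.
  rewrite ltnS; apply/leq_sizeP => l nl; rewrite /f1.
  have -> : linear_factor N D * (c%:P * 'X^n) =
      (c * D)%:P * 'X^(n.+1) - (c * N)%:P * 'X^n.
    by rewrite /linear_factor !polyCM exprS; ring.
  rewrite !coefB !coefCM !coefXn.
  move: nl; rewrite leq_eqVlt => /orP [/eqP <-|nl].
    by rewrite eqxx fc gtn_eqF // mulr1 mulr0 subr0 subrr.
  rewrite ((leq_sizeP _ _ sf) l nl) !gtn_eqF ?mulr0 ?subr0 //.
  exact: ltnW.
have [|g fE] := IH f1 sf1.
  exists B => // t Bt Dt; rewrite /f1 eval2D HB // add0r /eval2 rmorphN hornerN.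
  by rewrite -/(eval2 _ _ _) eval2M eval2_linear_factor mulrCA divff // mulr1 subrr mul0r oppr0.
by exists (g + c%:P * 'X^n); rewrite mulrDr -fE /f1 subrK.
Qed.

(** The roots are distinct, so the product of the linear factors divides [f]. Its leading
    coefficient in y is the product of the [D i], in degree [size s]; hence each root accounts for 1
    + deg D_i, that is [size (D i)], in the total degree. *)
Lemma bidegree_generic_roots (I : eqType) (s : seq I) (N D : I -> {poly F}) d f :
    uniq s -> f != 0 -> bidegree_le d f ->
    {in s, forall i, [/\ coprimep (N i) (D i), D i != 0
                      & generic_root f (N i) (D i)]} ->
    {in s &, forall i j, i != j -> N i * D j != N j * D i} ->
  (\sum_(i <- s) (size (D i)) <= d)%N.
Proof.
move=> us f0 fd fs Ns.
have [g fE] : exists g, f = \prod_(i <- s) linear_factor (N i) (D i) * g.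
  elim: s f {f0 fd} us fs Ns => [|i s IH] f /=.
    by exists f; rewrite big_nil mul1r.
  case/andP => nis us fs Ns; have [coi Di0 fi] := fs i (mem_head _ _).
  have [g fE] := generic_root_factor coi Di0 fi.
  have si j : j \in s -> j \in i :: s by rewrite inE orbC => ->.
  have [||g' gE] := IH g us; last first.
  - by exists g'; rewrite big_cons -mulrA -gE.
  - by move=> j k js ks; apply: Ns; apply: si.
  move=> j js; have [coj Dj0] := fs j (si j js); rewrite fE => gj.
  split=> //; apply: generic_rootM gj => //; apply: Ns; rewrite ?mem_head ?si //.
  by apply: contraTneq js => ->.
have D0 i : i \in s -> D i != 0 by case/fs.
have : (size s + \sum_(i <- s) (size (D i)).-1 <= d)%N; last first.
  rewrite -[size s]sum1_size -big_split /= !big_seq; congr (_ <= _)%N.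
  by apply: eq_bigr => i /D0; rewrite -size_poly_gt0 add1n => /prednK ->.
have g0 : g != 0 by apply: contraNneq f0; rewrite fE => ->; rewrite mulr0.
have lin i : i \in s -> size (linear_factor (N i) (D i)) = 2 /\
    lead_coef (linear_factor (N i) (D i)) = D i.
  move=> /D0 Di0; have := size_MXaddC; rewrite /linear_factor -polyCN => E.
  have sz : size ((D i)%:P * 'X + (- N i)%:P) = 2.
    by rewrite size_MXaddC polyC_eq0 (negPf Di0) /= size_polyC Di0.
  by rewrite lead_coefE sz /= coefD coefMX !coefC /= addr0.
have szlc : (size f = size s + size g)%N /\
    lead_coef f = \prod_(i <- s) D i * lead_coef g.
  rewrite fE; elim: s {fE fs us Ns D0} lin => [|i s IH] lin.
    by rewrite !big_nil !mul1r.
  have [|sz lc] := IH; first by move=> j js; apply: lin; rewrite inE js orbT.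
  have [szi lci] := lin i (mem_head _ _).
  rewrite !big_cons -!mulrA lead_coefM lc lci; split=> //.
  rewrite size_mul ?sz ?szi //; first by rewrite -size_poly_gt0 szi.
  by rewrite -size_poly_gt0 sz addn_gt0 size_poly_gt0 g0 orbT.
have [szf lcf] := szlc.
have := fd (size f).-1; rewrite -lead_coefE lcf.
have gs : (0 < size g)%N by rewrite size_poly_gt0.
rewrite size_mul ?lead_coef_eq0 //; last first.
  by rewrite prodf_seq_neq0; apply/allP => i /D0.
have lg : (0 < size (lead_coef g))%N by rewrite size_poly_gt0 lead_coef_eq0.
have -> : (\sum_(i <- s) (size (D i)).-1 = (size (\prod_(i <- s) D i)%R).-1)%N.
  rewrite size_prod_seq; last by move=> i /D0.
  rewrite subSKn -[size s]sum1_size !big_seq -sumnB; last first.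
    by move=> i /D0; rewrite size_poly_gt0.
  by apply: eq_bigr => i _; rewrite subn1.
have : (0 < size (\prod_(i <- s) D i)%R)%N.
  by rewrite size_poly_gt0 prodf_seq_neq0; apply/allP => i /D0.
move: gs lg; rewrite szf; move: (size _) (size _) (size _) (size _) => a b c e.
lia.
Qed.
End Bidegree.

(** * Degenerate drawings *)

Section Areas.
Variables n k : nat.
Local Notation p_ i := (@vp n k (inord i)).
Local Notation vertex := (ed_vertex n k).
Local Notation N := (size (ed_triangles n k)).

(* [rho false] and [rho true] are the two coordinates; twice the signed area. *)
Definition cross (A : nzRingType) (rho : bool -> vertex -> A) (a b c : vertex) : A :=
  (rho false b - rho false a) * (rho true c - rho true a)
  - (rho false c - rho false a) * (rho true b - rho true a).

Definition areas (A : nzRingType) (rho : bool -> vertex -> A) : seq A :=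
  [seq cross rho (tnth tri 0) (tnth tri 1) (tnth tri 2) | tri <- ed_triangles n k].

Lemma areasE (A : nzRingType) (rho : bool -> vertex -> A) : areas rho =
  [seq cross rho vS (p_ i) (p_ i.+1) | i <- iota 0 n.+1]
  ++ [seq cross rho vQ (vp' i) (p_ i.*2) | i : 'I_k <- enum 'I_k]
  ++ [seq cross rho vQ (p_ i.*2.+2) (vp' i) | i : 'I_k <- enum 'I_k]
  ++ [seq cross rho vQ (p_ i.+1) (p_ i) | i <- index_iota k.*2 n.+1]
  ++ [seq cross rho (p_ i.*2) (vp' i) (p_ i.*2.+1) | i : 'I_k <- enum 'I_k]
  ++ [seq cross rho (p_ i.*2.+2) (p_ i.*2.+1) (vp' i) | i : 'I_k <- enum 'I_k].
Proof. by rewrite /areas /ed_triangles !map_cat -!map_comp. Qed.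

Hypothesis k2n : (k.*2 <= n.+1)%N.

Lemma size_ed_triangles : N = (n.+1 + n.+1 + k + k)%N.
Proof.
rewrite /ed_triangles !size_cat !size_map !size_iota -!enumT !size_enum_ord.
by move: k2n; lia.
Qed.

Lemma areas_first (A : nzRingType) (rho : bool -> vertex -> A) i : (i <= n)%N ->
  (areas rho)`_i = cross rho vS (p_ i) (p_ i.+1).
Proof.
move=> lin; rewrite areasE nth_cat size_map size_iota ltnS lin.
by rewrite (nth_map 0%N) ?size_iota ?ltnS // nth_iota.
Qed.

Lemma areas_inner (A : nzRingType) (rho : bool -> vertex -> A) (i : 'I_k) :
  (areas rho)`_(n.+1 + n.+1 + i) = cross rho (p_ i.*2) (vp' i) (p_ i.*2.+1).
Proof.
have lik := ltn_ord i.
rewrite areasE !catA nth_cat !size_cat !size_map !size_iota -!enumT !size_enum_ord.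
rewrite ifT; last by move: k2n lik; lia.
rewrite nth_cat !size_cat !size_map !size_iota -!enumT !size_enum_ord.
rewrite ifF; last by move: k2n lik; lia.
set j := (_ - _)%N; have -> : j = i by rewrite /j; move: k2n lik; lia.
by rewrite (nth_map i) ?size_enum_ord // nth_ord_enum.
Qed.

Lemma areas_morph (A B : nzRingType) (f : {rmorphism A -> B})
    (rho : bool -> vertex -> A) (i : nat) :
  (areas (fun d v => f (rho d v)))`_i = f (areas rho)`_i.
Proof.
have -> : areas (fun d v => f (rho d v)) = map f (areas rho).
  rewrite /areas -map_comp; apply: eq_map => tri /=.
  by rewrite /cross rmorphB !rmorphM !rmorphB.
case: (ltnP i (size (areas rho))) => ii; first by rewrite (nth_map 0).
by rewrite [LHS]nth_default ?(size_map f) // nth_default // raddf0.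
Qed.

(** For the block of p_(2i), p'_(2i+1), p_(2i+1): no constraint, p_(2i+1) on the line S p_(2i), and
    the two components obtained when the inner area vanishes as well. *)
Inductive block_kind := Free | OnRay | Merged | BothOnRay.

(** Areas being invariant under translation, S is put at the origin; being an affine image of a
    parallelogram then reads P + R = Q. *)
Definition framed (A : nzRingType) (rho : bool -> vertex -> A) :=
  forall d, rho d vS = 0 /\ rho d (vp ord0) + rho d (vp ord_max) = rho d vQ.

(** The ratios [lam] and [mu] are explicit data, so that a drawing can be deformed within its family
    by moving them along with the free vertices. *)
Definition respects (A : nzRingType) (t : nat -> block_kind)
    (rho : bool -> vertex -> A) (lam mu : nat -> A) :=
  framed rho /\ forall (i : 'I_k) d,
    match t i with
    | Free => True
    | OnRay => rho d (p_ i.*2.+1) = lam i * rho d (p_ i.*2)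
    | Merged => rho d (p_ i.*2.+1) = rho d (p_ i.*2)
    | BothOnRay => rho d (p_ i.*2.+1) = lam i * rho d (p_ i.*2) /\
                   rho d (vp' i) = mu i * rho d (p_ i.*2)
    end.

Lemma respects_morph (A B : nzRingType) (f : {rmorphism A -> B}) t
    (rho : bool -> vertex -> A) lam mu :
  respects t rho lam mu ->
  respects t (fun d v => f (rho d v)) (fun i => f (lam i)) (fun i => f (mu i)).
Proof.
move=> [fr H]; split=> [d|i d].
  by have [-> <-] := fr d; rewrite rmorph0 rmorphD.
have := H i d; case: (t i) => // [->|->|[-> ->]] //; first by rewrite rmorphM.
by rewrite !rmorphM.
Qed.

Section Curve.
Variables (F : numFieldType) (t : nat -> block_kind).
Variables (rho : bool -> vertex -> F) (lam mu : nat -> F).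
Hypothesis rho_t : respects t rho lam mu.

Definition segment (a b : F) : {poly F} := a%:P + (b - a)%:P * 'X.

(** The common end of all curves. Even p_j are at (0, -1), odd ones, the p' and Q at (1, 0), and R
    at (1, 1), which keeps P + R = Q; this makes the areas to be annihilated equal to 1. *)
Definition reference_drawing (d : bool) (v : vertex) : F :=
  match v with
  | vS => 0
  | vQ => (~~ d)%:R
  | vp j => if j == ord_max then 1
            else if odd j then (~~ d)%:R else - d%:R
  | vp' _ => (~~ d)%:R
  end.

Let base d v := segment (rho d v) (reference_drawing d v).

(** Free vertices move linearly to the reference drawing and ratios linearly to 0; constrained
    vertices follow. At parameter 1 a vertex given by a ratio is therefore at S. *)
Definition curve (d : bool) (v : vertex) : {poly F} :=
  match v with
  | vp j =>
    if odd j && (j./2 < k)%N then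
      match t j./2 with
      | Free => base d v
      | Merged => base d (p_ j.-1)
      | _ => segment (lam j./2) 0 * base d (p_ j.-1)
      end
    else base d v
  | vp' i =>
    match t i with
    | BothOnRay => segment (mu i) 0 * base d (p_ i.*2)
    | _ => base d v
    end
  | _ => base d v
  end.

Lemma segment0 a b : (segment a b).[0] = a.
Proof. by rewrite /segment hornerD hornerM !hornerC hornerX mulr0 addr0. Qed.

Lemma segment1 a b : (segment a b).[1] = b.
Proof. by rewrite /segment hornerD hornerM !hornerC hornerX mulr1 addrC subrK. Qed.

Lemma inord_val i : (i <= n.+1)%N -> (inord i : 'I_n.+2) = i :> nat.
Proof. by move=> ?; rewrite inordK. Qed.

Lemma curve_even d i : (i.*2 <= n.+1)%N -> curve d (p_ i.*2) = base d (p_ i.*2).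
Proof. by move=> ii; rewrite /curve inord_val // odd_double. Qed.

Lemma curve_odd d (i : 'I_k) : curve d (p_ i.*2.+1) =
  match t i with
  | Free => base d (p_ i.*2.+1)
  | Merged => base d (p_ i.*2)
  | _ => segment (lam i) 0 * base d (p_ i.*2)
  end.
Proof.
rewrite /curve inord_val; last by move: k2n (ltn_ord i); lia.
by rewrite /= odd_double uphalf_double ltn_ord.
Qed.

Lemma curve_max d : curve d (vp ord_max) = base d (vp ord_max).
Proof.
rewrite /curve /= ifF //; apply/negP => /andP [/= on].
by move: k2n on; lia.
Qed.

Lemma curve_respects :
  respects t curve (fun i => segment (lam i) 0) (fun i => segment (mu i) 0).
Proof.
split=> [d|i d].
  rewrite curve_max; have [S0 PRQ] := rho_t.1 d.
  rewrite /curve /= /base /= S0 /segment subrr mul0r addr0; split=> //.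
  rewrite -PRQ eqxx; case: d {S0 PRQ}; rewrite /= !(polyCD, polyCN, polyC1, polyC0).
    by ring.
  by ring.
have i2 : (i.*2 <= n.+1)%N by move: k2n (ltn_ord i); lia.
by rewrite curve_odd curve_even //; case E: (t i) => //; rewrite /= E.
Qed.

Lemma curve0 d v : (curve d v).[0] = rho d v.
Proof.
have [_ H] := rho_t.
case: v => [||j|i]; rewrite ?segment0 //; last first.
  rewrite /curve; case E: (t i); rewrite /base ?hornerM !segment0 //.
  by have := H i d; rewrite E => -[_ ->].
case: (boolP (odd j && (j./2 < k)%N)) => [/andP [oj jk]|jN]; last first.
  by rewrite /curve (negPf jN) segment0.
have [i ->] : exists i : 'I_k, j = inord i.*2.+1.
  exists (Ordinal jk); apply: val_inj; rewrite /= inordK; first by move: oj; lia.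
  by move: (ltn_ord j) oj; lia.
rewrite curve_odd; have := H i d.
by case: (t _) => [_|->|->|[-> _]]; rewrite /base ?hornerM !segment0.
Qed.

Lemma horner_cross (g : bool -> vertex -> {poly F}) a b c x :
  (cross g a b c).[x] = cross (fun d v => (g d v).[x]) a b c.
Proof. by rewrite /cross !(hornerD, hornerN, hornerM). Qed.

Lemma reference_inner d i : (i <= n)%N ->
  reference_drawing d (p_ i) = if odd i then (~~ d)%:R else - d%:R.
Proof.
move=> lin; rewrite /= -val_eqE /= inord_val; last exact: leqW.
by rewrite ifF // ltn_eqF.
Qed.

Lemma curve1_first (i : 'I_k) : t i = Free ->
  ((areas curve)`_(i.*2)).[1] = 1.
Proof.
move=> ti; have i1 : (i.*2.+1 <= n)%N by move: k2n (ltn_ord i); lia.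
have i0 : (i.*2 <= n)%N by apply: ltnW.
rewrite areas_first // horner_cross /cross !curve_even ?curve_odd ?ti ?leqW //.
by rewrite /base !segment1 !reference_inner //= odd_double /=; ring.
Qed.

Lemma curve1_inner (i : 'I_k) : t i = OnRay ->
  ((areas curve)`_(n.+1 + n.+1 + i)).[1] = 1.
Proof.
move=> ti; have i1 : (i.*2.+1 <= n)%N by move: k2n (ltn_ord i); lia.
have i0 : (i.*2 <= n)%N by apply: ltnW.
rewrite areas_inner horner_cross /cross !curve_even ?curve_odd ?ti ?leqW //.
rewrite /= ti /base !hornerM !segment1 !reference_inner //.
by rewrite /= odd_double /=; ring.
Qed.

End Curve.
End Areas.

(** * Specializing the areas block by block *)

Section Specialization.
Variables (F : numFieldType) (n k : nat).
Hypothesis k2n : (k.*2 <= n.+1)%N.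
Local Notation N := (size (ed_triangles n k)).

Definition drawn (t : nat -> block_kind) (x : 'I_N -> F) :=
  exists rho : bool -> ed_vertex n k -> F, exists lam mu,
    respects t rho lam mu /\ forall j, x j = (areas rho)`_j.

(** Provides the curves required by [restrict_hyperplane]: the area of triangle [c] is 1 at their
    end, hence not identically zero. *)
Lemma drawn_curve t (c : 'I_N) :
    (forall (rho : bool -> ed_vertex n k -> F) lam mu, respects t rho lam mu ->
       ((areas (curve (F := F) t rho lam mu))`_c).[1] = 1) ->
  forall x, drawn t x -> exists g : 'I_N -> {poly F},
    [/\ forall s, drawn t (fun j => (g j).[s]), forall j, (g j).[0] = x j
      & g c != 0].
Proof.
move=> c1 x [rho [lam [mu [rt xE]]]].
exists (fun j => (areas (curve (F := F) t rho lam mu))`_j); split.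
- move=> s; have := respects_morph (horner_eval s) (curve_respects k2n rt).
  move=> rs; do 3 eexists; split; first exact: rs.
  by move=> j; rewrite areas_morph.
- move=> j; rewrite xE -horner_evalE -areas_morph; congr nth.
  rewrite /areas; apply: eq_map => tri.
  by rewrite /cross /= !horner_evalE !(curve0 k2n rt).
by apply/eqP => c0; have /eqP := c1 _ _ _ rt; rewrite c0 horner0 eq_sym oner_eq0.
Qed.

Definition set_kind (t : nat -> block_kind) i b j := if j == i then b else t j.

Lemma drawn_free (t : nat -> block_kind) (i : 'I_k) x : t i = OnRay ->
  drawn t x -> drawn (set_kind t i Free) x.
Proof.
move=> ti [rho [lam [mu [[fr H] xE]]]]; exists rho, lam, mu; split=> //.
split=> // j d; rewrite /set_kind; case: eqP => // _; exact: H.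
Qed.

Lemma drawn_on_ray (t : nat -> block_kind) (i : 'I_k) x :
    t i = Merged \/ t i = BothOnRay ->
  drawn t x -> drawn (set_kind t i OnRay) x.
Proof.
move=> ti [rho [lam [mu [[fr H] xE]]]].
(* A merged pair is on the ray with ratio 1, which replaces the stored ratio. *)
exists rho, (fun j : nat => if (j == i) && (if t i is Merged then true else false)
  then 1 else lam j), mu; split=> //.
split=> // j d; rewrite /set_kind; have := H j d.
case: eqP => [->|_] //=.
by case: ti => ->; [rewrite mul1r|case].
Qed.

Lemma outer_area0 (t : nat -> block_kind) (i : 'I_k) x (c : 'I_N) :
  c = i.*2 :> nat -> t i = OnRay -> drawn t x -> x c = 0.
Proof.
move=> ci ti [rho [lam [mu [[fr H] xE]]]]; rewrite xE ci areas_first; last first.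
  by move: k2n (ltn_ord i); lia.
have := H i; rewrite ti => E; rewrite /cross !E.
by rewrite !(fr _).1; ring.
Qed.

Lemma inner_area0 (t : nat -> block_kind) (i : 'I_k) x (c : 'I_N) :
    c = (n.+1 + n.+1 + i)%N :> nat -> t i = Merged \/ t i = BothOnRay ->
  drawn t x -> x c = 0.
Proof.
move=> ci ti [rho [lam [mu [[fr H] xE]]]]; rewrite xE ci areas_inner //.
have := H i; case: ti => -> E; rewrite /cross; first by rewrite !E; ring.
by rewrite !(E _).1 !(E _).2; ring.
Qed.

(* Indices of the triangles [S, p_(2i), p_(2i+1)] and [p_(2i), p'_(2i+1), p_(2i+1)]. *)
Definition degenerate i (j : nat) :=
  ~~ odd j && (j./2 < i)%N ||
  (n.+1 + n.+1 <= j)%N && (j < n.+1 + n.+1 + i)%N.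

Lemma degenerateS i (j : nat) : degenerate i.+1 j ->
  [|| degenerate i j || (j == i.*2) | j == n.+1 + n.+1 + i]%N.
Proof. by rewrite /degenerate; lia. Qed.

(** Each block takes two restrictions, from [Free] to [OnRay] and from there to the two final kinds.
    Both final kinds lie in the same [OnRay] family, so a single [r] serves all the components. *)
Lemma specialize_areas (p : {mpoly F[N]}) :
    p != 0 -> vanishes_on p (drawn (fun=> Free)) ->
  exists r, [/\ r != 0, (msize r <= msize p)%N,
    forall m (j : 'I_N), m \in msupp r -> degenerate k j -> m j = 0%N
    & forall t, (forall i, (i < k)%N -> t i = Merged \/ t i = BothOnRay) ->
        vanishes_on r (drawn t)].
Proof.
move=> p0 pZ.
suff sp l : (l <= k)%N -> exists r, [/\ r != 0, (msize r <= msize p)%N,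
    forall m (j : 'I_N), m \in msupp r -> degenerate l j -> m j = 0%N
    & forall t, (forall i, (i < l)%N -> t i = Merged \/ t i = BothOnRay) ->
        (forall i, (l <= i)%N -> t i = Free) -> vanishes_on r (drawn t)].
  have [r [r0 szr rJ rZ]]   := sp k (leqnn k).
  exists r; split=> // t tk x [rho [lam [mu [[fr H] xE]]]].
  apply: (rZ (fun i => if (i < k)%N then t i else Free)) => [i ik|i|].
  - by rewrite ik; apply: tk.
  - by rewrite leqNgt => /negPf ->.
  by exists rho, lam, mu; split=> //; split=> // i d; rewrite ltn_ord; apply: H.
elim: l => [|i IH] ik.
  exists p; split=> // [m j _|t _ tF x [rho [lam [mu [[fr H] xE]]]]].
    by rewrite /degenerate ltn0 andbF addn0 /= ltnNge andbN.
  by apply: pZ; exists rho, lam, mu; split=> //; split.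
have [r [r0 szr rJ rZ]] := IH (ltnW ik).
have iN0 : (i.*2 < N)%N by rewrite size_ed_triangles //; move: k2n; lia.
have iN1 : (n.+1 + n.+1 + i < N)%N by rewrite size_ed_triangles //; move: k2n; lia.
have [r1 [r10 szr1 r1J r1Z]] := restrict_hyperplane (Ordinal iN0) r0 rJ.
have [r2 [r20 szr2 r2J r2Z]] := restrict_hyperplane (Ordinal iN1) r10 r1J.
exists r2; split=> //.
- exact: leq_trans szr2 (leq_trans szr1 szr).
- move=> m j mr jE; apply: r2J mr _; exact: degenerateS jE.
pose o := Ordinal ik.
have r1OnRay t : (forall j, (j < i)%N -> t j = Merged \/ t j = BothOnRay) ->
    t i = OnRay -> (forall j, (i < j)%N -> t j = Free) -> vanishes_on r1 (drawn t).
  move=> ti tO tF x dx.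
  apply: (r1Z (drawn (set_kind t i Free))); last first.
  - by split; [apply: (@drawn_free t o)|apply: (@outer_area0 t o)].
  - apply: drawn_curve => rho lam mu rt.
    by apply: (@curve1_first _ _ k2n F _ rho lam mu o); rewrite /set_kind eqxx.
  apply: rZ => j ij; rewrite /set_kind; first by rewrite ltn_eqF //; apply: ti.
  by case: eqP => // /eqP ji; apply: tF; rewrite ltn_neqAle eq_sym ji.
move=> t ti tF x dx.
apply: (r2Z (drawn (set_kind t i OnRay))); last first.
- split; first by apply: (@drawn_on_ray t o) => //; apply: ti.
  by apply: (@inner_area0 t o) => //; apply: ti.
- apply: drawn_curve => rho lam mu rt.
  by apply: (@curve1_inner _ _ k2n F _ rho lam mu o); rewrite /set_kind eqxx.
apply: r1OnRay; rewrite /set_kind ?eqxx // => j ij.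
  by rewrite ltn_eqF //; apply: ti; apply: ltnW.
by rewrite gtn_eqF //; apply: tF.
Qed.
End Specialization.

(** * Linear coordinates on the degenerate area vectors *)

Section Realization.
Variables n k : nat.
Hypothesis k2n : (k.*2 <= n.+1)%N.
Local Notation N := (size (ed_triangles n k)).
Local Notation p_ i := (@vp n k (inord i)).

(* [V], [W], [a], [b] are linear coordinates on the space of area vectors
   annihilated by the degenerate triangles. The chain of vertices
   p_0, p_2, .., p_(2k), p_(2k+1), .., p_(n+1) is indexed by 0, .., n+1-k, and
   [V j] is the height of its [j]th vertex over the diagonal SQ. *)
Definition coords (A : nzRingType) (V W a b : nat -> A) : seq A :=
  [seq (if (i < k.*2)%N then if odd i then a i./2 else 0 else a (i - k)%N)
    | i <- iota 0 n.+1]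
  ++ [seq W i - V i | i : 'I_k <- enum 'I_k]
  ++ [seq b i - W i | i : 'I_k <- enum 'I_k]
  ++ [seq V (i.+1 - k)%N - V (i - k)%N - a (i - k)%N | i <- index_iota k.*2 n.+1]
  ++ [seq 0 | i : 'I_k <- enum 'I_k]
  ++ [seq V i.+1 - b i - a i | i : 'I_k <- enum 'I_k].

Lemma coords_morph (A B : nzRingType) (f : {rmorphism A -> B})
    (V W a b : nat -> A) i :
  (coords (fun j => f (V j)) (fun j => f (W j)) (fun j => f (a j))
    (fun j => f (b j)))`_i = f (coords V W a b)`_i.
Proof.
have -> : coords (fun j => f (V j)) (fun j => f (W j)) (fun j => f (a j))
    (fun j => f (b j)) = map f (coords V W a b).
  rewrite /coords !map_cat -!map_comp; congr (_ ++ (_ ++ (_ ++ (_ ++ (_ ++ _)))));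
    apply: eq_map => j /=; rewrite ?rmorphB ?rmorph0 //.
  by case: ifP => // _; case: ifP => // _; rewrite rmorph0.
case: (ltnP i (size (coords V W a b))) => ii; first by rewrite (nth_map 0).
by rewrite [LHS]nth_default ?(size_map f) // nth_default // raddf0.
Qed.

Section Draw.
Variables (F : numFieldType) (V W a b u : nat -> F) (t : nat -> block_kind).
Let m := (n.+1 - k)%N.
Let x j := u j * V j.+1 - u j.+1 * V j.

Hypotheses (u0m : u 0 + u m = 1) (V0m : V 0 + V m = 0).
Hypothesis plain : forall j, (k <= j < m)%N -> x j = a j.
Hypothesis block : forall j, (j < k)%N ->
  (t j = Merged /\ x j = a j /\ V j.+1 - V j - a j != 0) \/
  (t j = BothOnRay /\ x j * W j = V j * (V j.+1 - b j) /\ V j != 0 /\ x j != 0).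

Let P d j := if d then V j else u j.
Let Q (d : bool) : F := (~~ d)%:R.

Let base d j := if (j < k.*2)%N then P d j./2 else P d (j - k)%N.

(** The chain vertices are the points (u_j, V_j) and Q = (1, 0), so that [x j] is the area of S and
    two consecutive ones. In a merged block p' is located by its two areas with Q; otherwise
    p_(2i+1) and p' are the multiples of p_(2i) that produce the area [a] and the height [W]. *)
Let draw (d : bool) (v : ed_vertex n k) : F :=
  match v with
  | vS => 0
  | vQ => Q d
  | vp j => (if odd j && (j < k.*2)%N && (if t j./2 is Merged then false else true)
             then a j./2 / x j./2 else 1) * base d j
  | vp' i =>
    if t i is Merged
    then Q d + ((W i - V i) * (P d i.+1 - Q d) + (b i - W i) * (P d i - Q d))
               / (V i.+1 - V i - a i)
    else W i / V i * P d i
  end.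

Lemma draw_even d i : (i <= k)%N -> draw d (p_ i.*2) = P d i.
Proof.
move=> ik; rewrite /draw inord_val; last by move: k2n; lia.
rewrite odd_double mul1r /base doubleK; case: ifP => // ik2.
by congr (P d _); move: ik ik2; lia.
Qed.

Lemma draw_odd d i : (i < k)%N -> draw d (p_ i.*2.+1) =
  (if t i is Merged then 1 else a i / x i) * P d i.
Proof.
move=> ik; rewrite /draw inord_val; last by move: k2n ik; lia.
rewrite /base /= odd_double uphalf_double.
have -> : (i.*2.+1 < k.*2)%N by lia.
by case: (t i).
Qed.

Lemma draw_plain d i : (k.*2 <= i <= n.+1)%N -> draw d (p_ i) = P d (i - k)%N.
Proof.
case/andP=> ki lin; rewrite /draw inord_val // /base.
by rewrite ltnNge ki andbF mul1r.
Qed.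

Lemma both_b i : x i * W i = V i * (V i.+1 - b i) -> V i != 0 ->
  b i = V i.+1 - W i / V i * x i.
Proof.
move=> xw Vn; have -> : W i / V i * x i = x i * W i / V i by ring.
by rewrite xw; field.
Qed.

(** [u0m] and [V0m] amount to P + R = Q. The relation on [x] prescribes an area at S or, for the
    second kind, that of Q p_(2i+2) p'_(2i+1); the other areas come out of the construction. *)
Lemma drawn_coords : drawn t (fun j : 'I_N => (coords V W a b)`_j).
Proof.
exists draw, (fun i => a i / x i), (fun i => W i / V i).
split.
  split=> [d|i d].
    split=> //; have -> : ord0 = inord 0.*2 :> 'I_n.+2 by apply: val_inj; rewrite /= inordK.
    have -> : ord_max = inord n.+1 :> 'I_n.+2 by apply: val_inj; rewrite /= inordK.
    rewrite draw_even // draw_plain ?leqnn ?andbT //.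
    by case: d; rewrite /P /draw /Q.
  have ik := ltn_ord i; rewrite draw_odd // draw_even 1?ltnW //.
  have [[ti _]|[ti _]] := block ik; rewrite ti; first by rewrite mul1r.
  by rewrite /draw ti.
move=> j; congr nth; rewrite areasE /coords.
congr (_ ++ (_ ++ (_ ++ (_ ++ (_ ++ _))))).
- apply/eq_in_map => i; rewrite mem_iota add0n ltnS => /andP [_ lin].
  rewrite /cross; case: ltnP => ik; last first.
    rewrite !draw_plain; [|by move: ik lin; lia..].
    rewrite -plain; last by rewrite /m; move: ik lin; lia.
    by rewrite subSn; [rewrite /x /draw /P; ring|move: ik; lia].
  have i2k : (i./2 < k)%N by move: ik; lia.
  have iE : i = if odd i then (i./2).*2.+1 else (i./2).*2.
    by rewrite -[LHS](odd_double_half i); case: (odd i).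
  move: i2k iE; move: (i./2) => l i2k.
  have [[ti [xa Wn]]|[ti [xw [Vn xn]]]] := block i2k; case: (odd i) => ->.
  - rewrite -doubleS !draw_odd // !draw_even // ti /P /=.
    rewrite -xa /x. by ring.
  - rewrite !draw_odd // !draw_even 1?ltnW // ti /P /=.
    by ring.
  - rewrite -doubleS !draw_odd // !draw_even // ti /P /=.
    by move: xn; rewrite /x => xn; field.
  - rewrite !draw_odd // !draw_even 1?ltnW // ti /P /=.
    by ring.
- apply: eq_map => i; have ik := ltn_ord i.
  rewrite /cross !draw_even 1?ltnW //.
  have [[ti [xa Wn]]|[ti [xw [Vn xn]]]] := block ik; rewrite /draw ti /P /Q /=.
    by rewrite -xa /x in Wn *; field.
  by field.
- apply: eq_map => i; have ik := ltn_ord i.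
  rewrite -doubleS /cross !draw_even //.
  have [[ti [xa Wn]]|[ti [xw [Vn xn]]]] := block ik; rewrite /draw ti /P /Q /=.
    by rewrite -xa /x in Wn *; field.
  by rewrite (both_b xw Vn) /x; field.
- apply/eq_in_map => i; rewrite mem_index_iota => /andP [ki lin].
  rewrite /cross !draw_plain; [|by move: ki lin; lia..].
  rewrite -plain; last by rewrite /m; move: ki lin; lia.
  by rewrite subSn; [rewrite /x /draw /P /Q /=; ring|move: ki; lia].
- apply: eq_map => i; have ik := ltn_ord i.
  rewrite /cross !draw_odd // !draw_even 1?ltnW //.
  have [[ti [xa Wn]]|[ti [xw [Vn xn]]]] := block ik; rewrite /draw ti /P /Q /=.
    by ring.
  by ring.
apply: eq_map => i; have ik := ltn_ord i.
rewrite -doubleS /cross !draw_odd // !draw_even //.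
have [[ti [xa Wn]]|[ti [xw [Vn xn]]]] := block ik; rewrite /draw ti /P /Q /=.
  by rewrite -xa /x in Wn *; field.
by rewrite (both_b xw Vn) /x in xn *; field; rewrite xn Vn.
Qed.
End Draw.
End Realization.

(** * The branches of the degenerate variety *)

Section Branches.
Variables (F : numFieldType) (I : finType).
Implicit Types (s : nat -> F) (sg : nat -> bool).

(* A sequence [s] of scalars packs the data of a generic line with parameter
   ['X]: the heights are [v_0 = s 0] and [v_j = 'X - s (4j)], and the parameters
   of the [j]th step are [w_j = 'X - s (4j+1)], [a_j = s (4j+2)] and
   [b_j = s (4j+3)]. *)
Definition linV s j : {poly F} :=
  if j == 0%N then (s 0%N)%:P else 'X - (s (4 * j)%N)%:P.
Definition linW s j : {poly F} := 'X - (s (4 * j).+1)%:P.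

(* Numerator and denominator of [v_j (1 + h (x_0 + ... + x_(j-1)))], where
   [h = - v_0] and the [i]th step contributes [x_i = a_i / (v_i v_(i+1))] if
   [sg i] is false and [x_i = (v_(i+1) - b_i) / (w_i v_(i+1))] otherwise. *)
Fixpoint branch s sg j : {poly F} * {poly F} :=
  if j is i.+1 then
    let: (N, D) := branch s sg i in
    if sg i then
      (N * linV s j * linW s i - (s 0%N)%:P * (linV s j - (s (4 * i).+3)%:P) * D * linV s i,
       D * linV s i * linW s i)
    else (N * linV s j - (s 0%N * s (4 * i).+2)%:P * D, D * linV s i)
  else ((s 0%N)%:P, 1).

Definition num s sg j := (branch s sg j).1.
Definition den s sg j := (branch s sg j).2.

Lemma numS s sg j : num s sg j.+1 = if sg j
  then num s sg j * linV s j.+1 * linW s j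
       - (s 0%N)%:P * (linV s j.+1 - (s (4 * j).+3)%:P) * den s sg j * linV s j
  else num s sg j * linV s j.+1 - (s 0%N * s (4 * j).+2)%:P * den s sg j.
Proof. by rewrite /num /den /=; case: (branch s sg j) => N D; case: (sg j). Qed.

Lemma horner_numS s sg j x : (num s sg j.+1).[x] = if sg j
  then (num s sg j).[x] * (linV s j.+1).[x] * (linW s j).[x]
       - s 0%N * ((linV s j.+1).[x] - s (4 * j).+3) * (den s sg j).[x] * (linV s j).[x]
  else (num s sg j).[x] * (linV s j.+1).[x] - s 0%N * s (4 * j).+2 * (den s sg j).[x].
Proof.
rewrite numS; move: (linV s _) (linV s _) (linW s _) => V' V W.
by case: (sg j); rewrite !(hornerD, hornerN, hornerM, hornerC).
Qed.

Lemma denS s sg j : den s sg j.+1 =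
  den s sg j * linV s j * (if sg j then linW s j else 1).
Proof. by rewrite /den /=; case: (branch s sg j) => N D; case: (sg j); rewrite ?mulr1. Qed.

Lemma branch_ext s s' sg j : (forall i, (i <= 4 * j)%N -> s i = s' i) ->
  branch s sg j = branch s' sg j.
Proof.
elim: j => [|j IH] ss; first by rewrite /= ss.
have E i : (i <= 4 * j)%N -> s i = s' i by move=> ij; apply: ss; lia.
have e0 := ss 0%N isT; have e1 : s (4 * j).+1 = s' (4 * j).+1 by apply: ss; lia.
have e2 : s (4 * j).+2 = s' (4 * j).+2 by apply: ss; lia.
have e3 : s (4 * j).+3 = s' (4 * j).+3 by apply: ss; lia.
have e4 : s (4 * j.+1)%N = s' (4 * j.+1)%N by apply: ss.
have e5 : s (4 * j)%N = s' (4 * j)%N by apply: E.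
by rewrite /= IH // /linV /linW e0 e1 e2 e3 e4 e5.
Qed.

(** Values forbidden for the [i]th scalar, computed from earlier ones. They keep the linear factors
    distinct and, when a new height is chosen, keep the numerator and denominator coprime and the
    drawings nondegenerate. *)
Definition excluded (sgs : I -> nat -> bool) i s : seq F :=
  0 :: [seq s l | l <- iota 0 i] ++ [seq - s l | l <- iota 0 i] ++
  (if (0 < i)%N && (4 %| i)%N then
     let v := s (i - 4)%N in let w := s (i - 3)%N in
     let a := s (i - 2)%N in let b := s (i - 1)%N in
     [:: w + b; w - b; v - a] ++
     [seq v - s 0%N * a * (den s (sgs c) (i %/ 4).-1).[v]
             / (num s (sgs c) (i %/ 4).-1).[v]
       | c <- enum I]
   else [::]).

Lemma excluded_ext sgs i s s' : (forall l, (l < i)%N -> s l = s' l) ->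
  excluded sgs i s = excluded sgs i s'.
Proof.
move=> ss; rewrite /excluded; congr (_ :: (_ ++ (_ ++ _))).
- by apply/eq_in_map => l; rewrite mem_iota => /ss.
- by apply/eq_in_map => l; rewrite mem_iota => /ss ->.
case: ifP => // /andP [i0 i4].
have i3 : (4 <= i)%N by apply: dvdn_leq.
rewrite !ss; try by move: i3; lia.
congr (_ ++ _); apply: eq_map => sg.
by rewrite /num /den (@branch_ext s s') // => l li; apply: ss; move: i4 li; lia.
Qed.

Definition generic sgs M s := forall i, (i < M)%N -> s i \notin excluded sgs i s.

(** The scalars are chosen one after the other. [Q] stands for an open condition, later the
    nonvanishing of the restricted polynomial. *)
Lemma generic_exists (Q : (nat -> F) -> Prop) sgs M s :
    (forall s i (L : seq F), Q s -> exists2 c, c \notin L &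
       Q (fun l => if l == i then c else s l)) ->
  Q s -> exists2 s', Q s' & generic sgs M s'.
Proof.
move=> upd Qs; elim: M => [|M [s' Qs' gs]]; first by exists s.
have [c cL Qc] := upd _ M (excluded sgs M s') Qs'.
exists (fun l => if l == M then c else s' l) => // i.
rewrite ltnS leq_eqVlt => /orP [/eqP ->|iM].
  rewrite eqxx (@excluded_ext _ _ _ s') // => l lM.
  by rewrite ltn_eqF.
rewrite ltn_eqF // (@excluded_ext _ _ _ s'); first exact: gs.
by move=> l li; rewrite ltn_eqF // (ltn_trans li iM).
Qed.

Section Generic.
Variables (s : nat -> F) (sgs : I -> nat -> bool) (m : nat).
Hypothesis gen : generic sgs (4 * m) s.

Lemma gen_neq0 i : (i < 4 * m)%N -> s i != 0.
Proof. by move=> /gen; rewrite inE negb_or => /andP []. Qed.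

Lemma gen_neq i l : (l < i < 4 * m)%N -> s i != s l.
Proof.
case/andP => li /gen; rewrite inE mem_cat !negb_or => /and3P [_ + _].
apply: contra => /eqP ->; apply/mapP; exists l => //.
by rewrite mem_iota.
Qed.

Lemma gen_neqN i l : (l < i < 4 * m)%N -> s i != - s l.
Proof.
case/andP => li /gen; rewrite inE !mem_cat !negb_or => /and4P [_ _ + _].
apply: contra => /eqP ->; apply/mapP; exists l => //.
by rewrite mem_iota.
Qed.

Lemma gen_uniq i l : (i < 4 * m)%N -> (l < 4 * m)%N -> i != l -> s i != s l.
Proof.
move=> im lm; case: ltngtP => // il _; last by rewrite gen_neq ?il.
by rewrite eq_sym gen_neq ?il.
Qed.

Lemma gen_step j : (j.+1 < m)%N ->
  [/\ s (4 * j.+1)%N != s (4 * j).+1 + s (4 * j).+3,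
      s (4 * j.+1)%N != s (4 * j).+1 - s (4 * j).+3,
      s (4 * j.+1)%N != s (4 * j)%N - s (4 * j).+2 &
      forall c,
        s (4 * j.+1)%N != s (4 * j)%N - s 0%N * s (4 * j).+2 *
          (den s (sgs c) j).[s (4 * j)%N] / (num s (sgs c) j).[s (4 * j)%N]].
Proof.
move=> jm; have := @gen (4 * j.+1)%N; rewrite ltn_mul2l jm => /(_ isT).
rewrite inE !mem_cat !negb_or => /and4P [_ _ _].
have -> : (0 < 4 * j.+1)%N && (4 %| 4 * j.+1)%N by rewrite muln_gt0 dvdn_mulr.
rewrite mulKn // succnK mem_cat !inE !negb_or.
have -> : (4 * j.+1 - 4 = 4 * j)%N by lia.
have -> : (4 * j.+1 - 3 = (4 * j).+1)%N by lia.
have -> : (4 * j.+1 - 2 = (4 * j).+2)%N by lia.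
have -> : (4 * j.+1 - 1 = (4 * j).+3)%N by lia.
case/andP => /and3P [-> -> ->] H; split=> // c.
apply: contraNneq H => ->; apply/mapP; exists c => //.
by rewrite mem_enum.
Qed.

Hypothesis m0 : (0 < m)%N.
Variable c : I.
Let sg := sgs c.

Lemma linV_neq j x : (0 < j)%N -> x != s (4 * j)%N -> (linV s j).[x] != 0.
Proof. by rewrite /linV; case: j => // j _ xs; rewrite hornerXsubC subr_eq0. Qed.

Lemma linV_self j : (0 < j)%N -> (linV s j).[s (4 * j)%N] = 0.
Proof. by case: j => // j _; rewrite /linV hornerXsubC subrr. Qed.

Lemma linV_neq0 j : linV s j != 0.
Proof.
rewrite /linV; case: (j == 0%N); last by rewrite -size_poly_gt0 size_XsubC.
by rewrite polyC_eq0 gen_neq0 // muln_gt0.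
Qed.

Lemma linV_gen j i : (i < 4 * m)%N -> (j < m)%N -> i != (4 * j)%N ->
  (linV s j).[s i] != 0.
Proof.
move=> im jm ij; case: (posnP j) => [->|j0].
  by rewrite /linV eqxx hornerC gen_neq0 // muln_gt0.
by apply: linV_neq => //; apply: gen_uniq => //; rewrite ltn_mul2l.
Qed.

Lemma linW_gen j i : (i < 4 * m)%N -> (j < m)%N -> i != (4 * j).+1 ->
  (linW s j).[s i] != 0.
Proof.
move=> im jm ij; rewrite /linW hornerXsubC subr_eq0.
by apply: gen_uniq => //; move: jm; lia.
Qed.

Lemma den_root j x : root (den s sg j) x ->
  (exists2 l, (0 < l < j)%N & x = s (4 * l)%N) \/
  (exists2 l, (l < j)%N & sg l /\ x = s (4 * l).+1).
Proof.
elim: j => [|j IH]; first by rewrite /den /= (negPf (root1 _)).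
rewrite denS !rootM -orbA => /or3P [/IH|Vx|].
- by case=> [[l lj ->]|[l lj [sl ->]]]; [left|right]; exists l => //; lia.
- left; exists j; move: Vx; rewrite /linV; case: posnP => // j0.
  + by rewrite rootC (negPf (gen_neq0 _)) // muln_gt0.
  + by rewrite leqnn andbT.
  + by rewrite rootC (negPf (gen_neq0 _)) // muln_gt0.
  + by rewrite root_XsubC => /eqP.
by case: ifP => sj; rewrite ?root_XsubC ?(negPf (root1 _)) // => /eqP ->; right; exists j.
Qed.

Lemma den_gen j i : (4 * j <= i < 4 * m)%N -> (den s sg j).[s i] != 0.
Proof.
case/andP => ji im; apply/negP => /den_root [[l lj /eqP]|[l lj [_ /eqP]]].
  by rewrite (negPf (gen_uniq _ _ _)) //; move: lj im ji; lia.
by rewrite (negPf (gen_uniq _ _ _)) //; move: lj im ji; lia.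
Qed.

Lemma den_gen_linW j l : (j <= m)%N -> (l < m)%N -> ~~ ((l < j)%N && sg l) ->
  (den s sg j).[s (4 * l).+1] != 0.
Proof.
move=> jm lm; apply: contraNneq => /eqP /den_root [[i ij /eqP]|[i ij [si /eqP]]].
  by rewrite (negPf (gen_uniq _ _ _)) //; move: lm ij jm; lia.
apply: contraTT => H; apply: gen_uniq; [by move: lm; lia|by move: ij jm; lia|].
by apply: contra H => /eqP il; have -> : l = i by [move: il; lia]; rewrite ij si.
Qed.

Lemma den_linW j l : (l < j)%N -> sg l -> (den s sg j).[s (4 * l).+1] = 0.
Proof.
elim: j => // j IH; rewrite ltnS leq_eqVlt denS !hornerM => /orP [/eqP ->|lj] sl.
  by rewrite sl /linW hornerXsubC subrr mulr0.
by rewrite IH // !mul0r.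
Qed.

Lemma den_root_linW j : sg j -> root (den s sg j.+1) (s (4 * j).+1).
Proof. by move=> sj; rewrite /root den_linW. Qed.

Lemma den_neq0 j : den s sg j != 0.
Proof.
elim: j => [|j IH]; first exact: oner_neq0.
rewrite denS !mulf_neq0 ?linV_neq0 //.
by case: ifP; rewrite ?oner_neq0 // /linW -size_poly_gt0 size_XsubC.
Qed.

(** The factor v_0 is constant, so only [j] of the factors v_0, .., v_j count. *)
Lemma size_den j :
  size (den s sg j.+1) = (j + \sum_(i < j.+1) sg i).+1.
Proof.
have sW i D : D != 0 -> size (D * (if sg i then linW s i else 1)) = (size D + sg i)%N.
  move=> D0; case: (sg i); last by rewrite mulr1 addn0.
  by rewrite size_mul -?size_poly_gt0 /linW ?size_XsubC ?size_poly_gt0 // addn2 addn1.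
elim: j => [|j IH].
  rewrite denS sW ?mulf_neq0 ?den_neq0 ?linV_neq0 // big_ord1 /den /= mul1r.
  by rewrite /linV /= size_polyC gen_neq0 // muln_gt0.
rewrite denS sW ?mulf_neq0 ?den_neq0 ?linV_neq0 // size_mul ?den_neq0 ?linV_neq0 //.
rewrite IH [in RHS]big_ord_recr /= size_XsubC -[2%R]/2%N. lia.
Qed.

Lemma coprimep_linV p j :
  ((0 < j)%N -> p.[s (4 * j)%N] != 0) -> coprimep p (linV s j).
Proof.
rewrite /linV; case: posnP => [_ _|j0 /(_ isT) px].
  by rewrite -alg_polyC coprimepZr ?coprimep1 // gen_neq0 // muln_gt0.
by rewrite coprimep_XsubC.
Qed.

Lemma coprimep_den j (p : {poly F}) :
  (forall x, root (den s sg j) x -> p.[x] != 0) -> coprimep p (den s sg j).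
Proof.
elim: j => [|j IH] px; first by rewrite /den /= coprimep1.
rewrite denS !coprimepMr IH ?coprimep_linV //=.
- case: ifP => sj; rewrite ?coprimep1 // /linW coprimep_XsubC; apply: px.
  by rewrite den_root_linW.
- move=> j0; apply: px; rewrite denS !rootM [X in _ || X || _]/root linV_self //.
  by rewrite eqxx orbT.
by move=> x rx; apply: px; rewrite denS !rootM rx.
Qed.

Lemma s0_neq0 : s 0%N != 0.
Proof. by rewrite gen_neq0 // muln_gt0. Qed.

(** At the root of v_j the recursion leaves a single product of nonzero factors from the previous
    step. *)
Lemma num_linV j : (0 < j < m)%N -> (num s sg j).[s (4 * j)%N] != 0.
Proof.
case: j => // j; rewrite ltnS => /andP [_ jm].
have Dn : (den s sg j).[s (4 * j.+1)%N] != 0 by apply: den_gen; lia.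
rewrite horner_numS; case: (sg j); rewrite linV_self //.
  rewrite mulr0 mul0r !sub0r oppr_eq0 !mulf_neq0 ?s0_neq0 //.
    by rewrite oppr_eq0 gen_neq0 //; move: jm; lia.
  by apply: linV_gen; move: jm; lia.
rewrite mulr0 sub0r oppr_eq0 !mulf_neq0 ?s0_neq0 //.
by rewrite gen_neq0 //; move: jm; lia.
Qed.

(** At a root of the old denominator the recursion leaves the term with the old numerator, nonzero
    by induction; at the root of w_j it leaves the other term; at the root of v_j both may survive,
    and genericity prevents their cancellation. *)
Lemma coprimep_num_den j : (j < m)%N -> coprimep (num s sg j) (den s sg j).
Proof.
elim: j => [|j IH] jm; first by rewrite /den /= coprimep1.
have jm' := ltnW jm; have {}IH := IH jm'.
have v0 := s0_neq0; have [g1 g2 _ g3] := gen_step jm.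
have V'n i : (i < 4 * j.+1)%N -> (linV s j.+1).[s i] != 0.
  by move=> ij; apply: linV_gen => //; move: ij jm; lia.
have Wn i : (i < 4 * j.+1)%N -> i != (4 * j).+1 -> (linW s j).[s i] != 0.
  by move=> ij iw; apply: linW_gen => //; move: ij jm; lia.
apply: coprimep_den => x; rewrite denS !rootM -orbA => /or3P [Dx|Vx|].
- have Nx : (num s sg j).[x] != 0.
    by apply: (coprimep_root _ Dx); rewrite coprimep_sym.
  have [i ij xE] : exists2 i, (i < 4 * j)%N & x = s i.
    case: (den_root Dx) => [[l lj ->]|[l lj [_ ->]]]; eexists; try reflexivity.
      by move: lj; lia.
    by move: lj; lia.
  rewrite horner_numS; case: (sg j);
    rewrite (rootP Dx) !(mulr0, mul0r) subr0 !mulf_neq0 // xE.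
  + by apply: V'n; move: ij; lia.
  + by apply: Wn; move: ij; lia.
  + by apply: V'n; move: ij; lia.
- have [j0 xE] : (0 < j)%N /\ x = s (4 * j)%N.
    move: Vx; rewrite /linV; case: posnP => [_|j0].
      by rewrite rootC (negPf v0).
    by rewrite root_XsubC => /eqP.
  have Nx : (num s sg j).[x] != 0 by rewrite xE num_linV ?j0.
  rewrite horner_numS; case: (sg j).
    rewrite (rootP Vx) !(mulr0, mul0r) subr0 !mulf_neq0 // xE.
      by apply: V'n; lia.
    by apply: Wn; lia.
  apply: contraNneq (g3 c) => /eqP; rewrite -/sg xE /linV /= hornerXsubC subr_eq0.
  (* Solving for the scalar in v_(j+1) that would make the numerator vanish gives a value in
     [excluded]. *)
  have E (N0 v v' e : F) : N0 != 0 -> N0 * (v - v') = e -> v' = v - e / N0.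
    by move=> n0 <-; field.
  by move=> /eqP H; rewrite (E _ _ _ _ _ H) // -xE.
case sj: (sg j); last by rewrite (negPf (root1 _)).
rewrite /linW root_XsubC => /eqP ->; rewrite horner_numS sj [(linW _ _).[_]]hornerXsubC subrr.
rewrite mulr0 sub0r oppr_eq0 !mulf_neq0 //.
- rewrite /linV /= hornerXsubC; apply: contraNneq g2 => H.
  by rewrite -subr_eq0 -oppr_eq0; apply/eqP; rewrite -[RHS]H; ring.
- by apply: den_gen; move: jm; lia.
- by apply: linV_gen; move: jm; lia.
Qed.

Lemma coprimep_num_linV j : (j < m)%N -> coprimep (num s sg j) (linV s j).
Proof. by move=> jm; apply: coprimep_linV => j0; rewrite num_linV ?j0. Qed.
End Generic.
End Branches.

(** * The branches as graphs of rational functions *)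

Section BranchRoots.
Variables (F : numFieldType) (I : finType) (s : nat -> F) (sgs : I -> nat -> bool).
Variable q : nat.
Hypothesis q0 : (0 < q)%N.
Hypothesis gen : generic sgs (4 * q.+1) s.
Let m0 : (0 < q.+1)%N := isT.

(* The root [y] of the relation [v_(q+1) (1 + h (x_0 + ... + x_q)) = 0] in which
   [a_q] and [b_q] are both shifted by [y]. *)
Definition root_num sg : {poly F} :=
  if sg q then (- s 0%N - s (4 * q).+3)%:P * den s sg q * linV s q
               + linW s q * num s sg q
  else - num s sg q - (s (4 * q).+2)%:P * den s sg q.
Definition root_den sg : {poly F} := den s sg q * (if sg q then linV s q else 1).

Lemma coprimep_root_num_den c : coprimep (root_num (sgs c)) (root_den (sgs c)).
Proof.
rewrite /root_num /root_den; set sg := sgs c.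
have co := coprimep_num_den gen m0 c (ltnSn q).
have coV := coprimep_num_linV gen m0 c (ltnSn q).
case sq: (sg q); last first.
  rewrite mulr1 coprimep_sym -opprD addrC -scaleN1r coprimepZr ?oppr_eq0 ?oner_neq0 //.
  by rewrite coprimep_addl_mul coprimep_sym.
rewrite coprimep_sym -mulrA coprimep_addl_mul coprimepMr !coprimepMl.
rewrite ![coprimep _ (num _ _ _)]coprimep_sym co coV !andbT.
rewrite /linW !coprimep_XsubC /root.
rewrite -/(linW s q) (den_gen gen m0) ?(linV_gen gen m0) //; lia.
Qed.

Lemma root_den_neq0 c : root_den (sgs c) != 0.
Proof.
rewrite /root_den mulf_neq0 ?(den_neq0 gen m0) //.
by case: ifP; rewrite ?oner_neq0 ?(linV_neq0 gen m0 _).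
Qed.

Lemma size_root_den c :
  size (root_den (sgs c)) = (q + \sum_(i < q.+1) sgs c i)%N.
Proof.
rewrite /root_den big_ord_recr /=.
have := size_den gen m0 c q.-1; rewrite prednK // => sD.
have D0 := den_neq0 gen m0 c q.
case: (sgs c q); last by rewrite mulr1 sD -addSn prednK // addn0.
have V0 := linV_neq0 gen m0 q.
have sV : size (linV s q) = 2%N by rewrite /linV gtn_eqF // size_XsubC.
by rewrite size_mul // sD sV addn2 /= addn1 addnS -addSn prednK.
Qed.

(** The root of w_l, or of v_q when l = q, is a pole of the first fraction by coprimality, but not
    of the second. *)
Lemma root_den_separated c1 c2 l : (l < q.+1)%N -> sgs c1 l -> ~~ sgs c2 l ->
  root_num (sgs c1) * root_den (sgs c2) != root_num (sgs c2) * root_den (sgs c1).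
Proof.
move=> lq s1 s2.
have [x Dx D'x] : exists2 x, root (root_den (sgs c1)) x & (root_den (sgs c2)).[x] != 0.
  move: lq; rewrite ltnS leq_eqVlt => /orP [/eqP lE|lq].
    rewrite /root_den -lE s1 (negPf s2); exists (s (4 * l)%N).
      by rewrite rootM /root [X in _ || X]/= linV_self ?lE // eqxx orbT.
    by rewrite mulr1 (den_gen gen m0) // lE; lia.
  exists (s (4 * l).+1); first by rewrite /root_den rootM /root (den_linW _ lq) // eqxx.
  rewrite /root_den hornerM mulf_neq0 //.
    by apply: (den_gen_linW gen m0); rewrite ?s2 ?lq //; lia.
  case: ifP; rewrite ?hornerC ?oner_neq0 // => _.
  by apply: (linV_gen gen m0); move: lq; lia.
apply: contraTneq D'x => E; rewrite negbK.
have : (root_num (sgs c1)).[x] != 0.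
  by apply: (coprimep_root _ Dx); rewrite coprimep_sym coprimep_root_num_den.
have /(congr1 (fun p : {poly F} => p.[x])) := E; rewrite [LHS]hornerM [RHS]hornerM.
by rewrite (rootP Dx) mulr0 => /eqP; rewrite mulf_eq0 => /orP [->|].
Qed.

(** The first factor controls the v_j and, for the second kind, the w_j; the other two give the
    inequalities of [drawn_coords] for the steps before the last and for the last one, which ends at
    height h = - s_0. *)
Definition nondegeneracy sg : {poly F} :=
  den s sg q.+1 *
  (\prod_(j < q) if sg j then linV s j.+1 - (s (4 * j).+3)%:P
                 else linV s j.+1 - linV s j - (s (4 * j).+2)%:P) *
  (if sg q then num s sg q
   else (- (s 0%N)%:P - linV s q) * den s sg q + num s sg q).

Lemma nondegeneracy_neq0 c : nondegeneracy (sgs c) != 0.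
Proof.
have v0 := s0_neq0 gen m0; set sg := sgs c.
rewrite /nondegeneracy !mulf_neq0 ?(den_neq0 gen m0) //.
  apply/prodf_neq0 => j _; have jq := ltn_ord j.
  have [_ _ g3 _] := gen_step gen (jq : (j.+1 < q.+1)%N).
  rewrite /linV /=; case: (sg j).
    by rewrite -addrA -opprD -polyCD -size_poly_gt0 size_XsubC.
  case: posnP => [->|j0].
    by rewrite -!addrA -!opprD -!polyCD -size_poly_gt0 size_XsubC.
  rewrite (_ : _ - _ = (s (4 * j)%N - s (4 * j.+1)%N - s (4 * j).+2)%:P); last first.
    by rewrite !polyCB; ring.
  rewrite polyC_eq0; apply: contraNneq g3 => H.
  by rewrite -subr_eq0 -oppr_eq0; apply/eqP; rewrite -[RHS]H; ring.
suff [x nx] : exists x, (if sg q then num s sg q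
   else (- (s 0%N)%:P - linV s q) * den s sg q + num s sg q).[x] != 0.
  by apply: contraNneq nx => ->; rewrite horner0.
(* At the root of v_q the recursion turns this factor into a product whose remaining linear factor
   is nonzero by genericity. *)
exists (s (4 * q)%N); case: (sg q).
  by apply: (num_linV gen m0); rewrite q0 /=.
case: q q0 gen => // j _ gj.
have m1 : (0 < j.+2)%N by [].
have [g1 _ g3 _] := gen_step gj (ltnSn j.+1).
have Vn : (linV s j).[s (4 * j.+1)%N] != 0 by apply: (linV_gen gj); lia.
have Dn : (den s sg j).[s (4 * j.+1)%N] != 0 by apply: (den_gen gj); lia.
rewrite hornerD horner_numS denS 2!hornerM hornerD hornerN hornerC.
rewrite hornerN (linV_self s (isT : (0 < j.+1)%N)).
case: (sg j); last first.
  rewrite hornerM hornerC.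
  have An : (linV s j).[s (4 * j.+1)%N] + s (4 * j).+2 != 0.
    rewrite /linV; case: posnP => [->|j0].
      rewrite hornerC addrC addr_eq0 (gen_neqN gj) //; lia.
    rewrite hornerXsubC; apply: contraNneq g3 => H.
    by rewrite -subr_eq0; apply/eqP; rewrite -[RHS]H; ring.
  have := mulf_neq0 (mulf_neq0 v0 Dn) An; rewrite -oppr_eq0.
  by congr (_ != 0); ring.
rewrite hornerM [(linW s j).[_]]hornerXsubC.
have An : s (4 * j.+1)%N - s (4 * j).+1 - s (4 * j).+3 != 0.
  apply: contraNneq g1 => H.
  by rewrite -subr_eq0; apply/eqP; rewrite -[RHS]H; ring.
have := mulf_neq0 (mulf_neq0 (mulf_neq0 v0 Dn) Vn) An; rewrite -oppr_eq0.
by congr (_ != 0); ring.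
Qed.

End BranchRoots.

(** * Points of the branches are area vectors *)

Section RootsAreDrawn.
Variables (F : numFieldType) (n k q : nat) (s : nat -> F) (sg : nat -> bool) (tau : F).
Hypothesis k2n : (k.*2 <= n.+1)%N.
Hypothesis qE : (q + k)%N = n.
Hypothesis sgk : forall j, sg j -> (j < k)%N.
Hypothesis v0 : s 0%N != 0.
Hypothesis q0 : (0 < q)%N.
Hypothesis nd : (nondegeneracy s q sg).[tau] != 0.

Definition height (m : nat) (A : nzRingType) (h : A) (V : nat -> A) j :=
  if j == m then h else V j.

Let v j := (linV s j).[tau].
Let w j := (linW s j).[tau].
Let d j := (den s sg j).[tau].
Let e j := (num s sg j).[tau] / d j.
Let h := - s 0%N.
Let y := (root_num s q sg).[tau] / (root_den s q sg).[tau].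
Let V := height q.+1 h v.
Let a j := s (4 * j).+2 + (if j == q then y else 0).
Let b j := s (4 * j).+3 + (if j == q then y else 0).
(** Solves x_j = u_j V_(j+1) - u_(j+1) V_j successively from u_0 = 0, the quotients u_j / v_j
    telescoping; the final value 1 is forced by P + R = Q. *)
Let u j := if j == q.+1 then 1 else (v j - e j) / h.

Lemma den_step j : (j <= q)%N -> [/\ d j != 0, v j != 0 & sg j -> w j != 0].
Proof.
have dS i : d i.+1 != 0 -> [/\ d i != 0, v i != 0 & sg i -> w i != 0].
  rewrite /d denS 2!hornerM !mulf_eq0 !negb_or -!andbA => /and3P [? ? H].
  by split=> // si; move: H; rewrite si.
have dq : d q.+1 != 0.
  by move: nd; rewrite /nondegeneracy 2!hornerM !mulf_eq0 !negb_or -andbA => /and3P [].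
move=> jq; suff: d j.+1 != 0 by move=> /dS.
have H l : (l <= q - j)%N -> d (q.+1 - l)%N != 0.
  elim: l => [|l IH] lj; first by rewrite subn0.
  have /dS [] : d (q.+1 - l.+1).+1 != 0; last by [].
  by rewrite subSS -subSn; [apply: IH; apply: ltnW|move: lj; lia].
by have := H _ (leqnn _); have -> : (q.+1 - (q - j) = j.+1)%N by lia.
Qed.

Lemma inner_nondegenerate j : (j < q)%N ->
  if sg j then v j.+1 - s (4 * j).+3 != 0 else v j.+1 - v j - s (4 * j).+2 != 0.
Proof.
move=> jq; move: nd; rewrite /nondegeneracy 2!hornerM !mulf_eq0 !negb_or -andbA.
case/and3P => _ + _; rewrite horner_prod => /prodf_neq0 /(_ (Ordinal jq) isT).
rewrite /v [nat_of_ord _]/=; move: (linV s j.+1) (linV s j) => V' V0.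
by case: (sg j); rewrite !(hornerD, hornerN, hornerC).
Qed.

Let x j := u j * V j.+1 - u j.+1 * V j.

Lemma step_inner j : (j < q)%N ->
  if sg j then x j * w j = V j * (V j.+1 - b j) else x j = a j.
Proof.
move=> jq; have [dn vn wn] := den_step (ltnW jq).
have h0 : h != 0 by rewrite oppr_eq0.
have E0 : (j == q) = false by rewrite ltn_eqF.
have E1 : (j == q.+1) = false by rewrite ltn_eqF // ltnW.
have E2 : (j.+1 == q.+1) = false by rewrite ltn_eqF.
rewrite /x /u /V /height /a /b E0 E1 E2 !addr0.
rewrite /e /d horner_numS denS 2!hornerM -/(d j) -/(v j) -/(v j.+1) -/(w j).
case sj: (sg j); last first.
  by rewrite hornerC /h; field; rewrite dn vn v0.
by have wj := wn sj; rewrite -/(w j) /h; field; rewrite dn vn v0 wj.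
Qed.

(** With [u] fixed at both ends, one relation remains; [y] is the shift of a_q or b_q that satisfies
    it. *)
Lemma step_last : [/\ x q = - e q, ~~ sg q -> a q = - e q
  & sg q -> b q = h + w q * e q / v q].
Proof.
have [dn vn wn] := den_step (leqnn q).
have h0 : h != 0 by rewrite oppr_eq0.
split.
- rewrite /x /u /V /height eqxx ltn_eqF //; field; exact: h0.
- move=> /negPf sq; rewrite /a eqxx /y /root_num /root_den sq mulr1.
  by rewrite !(hornerD, hornerN, hornerM, hornerC) -/(d q) /e; field.
move=> sq; rewrite /b eqxx /y /root_num /root_den sq.
move: dn vn; rewrite /e /h /v /w /d.
move: (linV s q) (linW s q) (den s sg q) (num s sg q) => V0 W0 D0 N0 dn vn.
by rewrite !(hornerD, hornerN, hornerM, hornerC); field; rewrite dn vn.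
Qed.

Lemma drawn_root :
  drawn (fun j => if sg j then BothOnRay else Merged)
    (fun j : 'I_(size (ed_triangles n k)) => (coords n k V w a b)`_j).
Proof.
have mE : (n.+1 - k = q.+1)%N by rewrite -qE; lia.
have [xl al bl] := step_last.
have [dq vq wq] := den_step (leqnn q).
have h0 : h != 0 by rewrite oppr_eq0.
have VE j : (j <= q)%N -> V j = v j by move=> jq; rewrite /V /height ltn_eqF.
apply: (@drawn_coords n k k2n F V w a b u).
- rewrite mE /u eqxx /= /e /d /v /= /den /num /linV /= !hornerC divr1 subrr.
  by rewrite mul0r add0r.
- by rewrite mE /V /height eqxx /= /v /linV hornerC /h subrr.
- move=> j; rewrite mE ltnS => /andP [kj jq]; have := jq.
  have sj : sg j = false by apply/negP => /sgk; rewrite ltnNge kj.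
  rewrite leq_eqVlt => /orP [/eqP jE|jl]; last by have := step_inner jl; rewrite sj.
  by rewrite jE in sj *; rewrite -/(x q) xl al ?sj.
move=> j jk; have jq : (j <= q)%N by move: k2n; rewrite -qE; lia.
have [dj vj wj] := den_step jq.
have := jq; rewrite leq_eqVlt => /orP [/eqP jE|jl].
  rewrite jE; case sq: (sg q); [right|left]; split=> //.
    rewrite -/(x q) xl (bl sq) (VE q (leqnn q)) /V /height eqxx; split; first by field.
    split=> //; rewrite oppr_eq0 mulf_neq0 ?invr_eq0 //.
    by move: nd; rewrite /nondegeneracy hornerM mulf_eq0 sq negb_or => /andP [].
  have aq : a q = - e q by apply: al; rewrite sq.
  rewrite -/(x q) xl aq; split=> //; rewrite (VE q (leqnn q)) /V /height eqxx.
  move: nd; rewrite /nondegeneracy hornerM mulf_eq0 sq negb_or => /andP [_].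
  rewrite hornerD hornerM hornerD hornerN hornerN hornerC -/(v q) -/(d q) => H.
  apply: contraNneq H => H.
  have -> : (num s sg q).[tau] = e q * d q by rewrite divfK.
  rewrite -mulrDl; have -> : - s 0%N - v q + e q = h - v q - - e q by rewrite opprK.
  by rewrite H mul0r.
have := step_inner jl; have := inner_nondegenerate jl.
case sj: (sg j) => nj xj; [right|left]; split=> //; rewrite -/(x j); split=> //.
  split; first by rewrite VE.
  have: x j * w j != 0; last by rewrite mulf_eq0 negb_or => /andP [].
  by rewrite xj !VE // mulf_neq0 // /b ltn_eqF // addr0.
by rewrite !VE // /a ltn_eqF // addr0.
Qed.

End RootsAreDrawn.

(** * A generic pencil *)

Section GenericPoint.
Variables (F : numFieldType) (n k q : nat).
Hypothesis k2n : (k.*2 <= n.+1)%N.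
Hypothesis qE : (q + k)%N = n.
Local Notation N := (size (ed_triangles n k)).

Lemma eq_coords (A : nzRingType) (V W a b V' W' a' b' : nat -> A) :
  V =1 V' -> W =1 W' -> a =1 a' -> b =1 b' ->
  coords n k V W a b = coords n k V' W' a' b'.
Proof.
move=> VV' WW' aa' bb'; rewrite /coords.
congr (_ ++ (_ ++ (_ ++ (_ ++ (_ ++ _)))));
  by apply: eq_map => j; rewrite ?VV' ?WW' ?aa' ?bb'.
Qed.

(** The point tau = y = 0 of the pencil, as a linear function of the scalars. *)
Definition base_coords (A : nzRingType) (s : nat -> A) : seq A :=
  coords n k
    (height q.+1 (- s 0%N) (fun j => if j == 0%N then s 0%N else - s (4 * j)%N))
    (fun j => - s (4 * j).+1) (fun j => s (4 * j).+2) (fun j => s (4 * j).+3).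

Lemma base_coords_morph (A B : nzRingType) (f : {rmorphism A -> B}) s s' i :
  (forall j, f (s j) = s' j) -> (base_coords s')`_i = f (base_coords s)`_i.
Proof.
move=> ss; rewrite -coords_morph; congr nth; apply: eq_coords => j //.
- rewrite /height; case: ifP => _; first by rewrite rmorphN ss.
  by case: ifP => _; rewrite ?rmorphN ss.
- by rewrite rmorphN ss.
Qed.

Lemma map_iota_ord (T : Type) (X : nat -> T) c l :
  map X (iota c l) = [seq X (c + i)%N | i : 'I_l <- enum 'I_l].
Proof.
by rewrite -{1}[c]addn0 iotaDl -val_enum_ord -!map_comp.
Qed.

(** Used to find a base point where the restricted polynomial, which involves only the nondegenerate
    areas, is nonzero. *)
Lemma base_coords_onto (x : 'I_N -> F) :
    (forall j : 'I_N, degenerate n k j -> x j = 0) ->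
  exists s, forall j : 'I_N, (base_coords s)`_j = x j.
Proof.
move=> x0; pose X l := [seq x j | j <- enum 'I_N]`_l.
have XE (j : 'I_N) : X j = x j.
  by rewrite /X (nth_map j) ?size_enum_ord // nth_ord_enum.
have X0 l : (l < N)%N -> degenerate n k l -> X l = 0.
  by move=> lN dl; rewrite (XE (Ordinal lN)) x0.
pose a j := if (j < k)%N then X j.*2.+1 else X (j + k)%N.
pose B j := X (n.+1 + j)%N.
pose B' j := X (n.+1 + k + j)%N.
pose C j := X (n.+1 + n.+1 + k + j)%N.
(* These are the increments of the heights, read off as sums of areas; [V0] is then determined by
   V_0 + V_(q+1) = 0. *)
pose d j := if (j < k)%N then a j + B j + B' j + C j else a j + X (n.+1 + (j + k))%N.
pose V0 := - (\sum_(l < q.+1) d l) / 2.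
pose V j := V0 + \sum_(l < j) d l.
pose W j := B j + V j.
pose b j := B' j + W j.
pose s l := nth 0 [:: (if l == 0%N then V0 else - V (l %/ 4)%N); - W (l %/ 4)%N;
  a (l %/ 4)%N; b (l %/ 4)%N] (l %% 4).
have dv j c : (c < 4)%N -> ((4 * j + c) %/ 4 = j)%N /\ ((4 * j + c) %% 4 = c)%N by lia.
have s1 j : s (4 * j).+1 = - W j.
  by rewrite /s -addn1; have [-> ->] := dv j 1%N isT.
have s2 j : s (4 * j).+2 = a j.
  by rewrite /s -addn2; have [-> ->] := dv j 2%N isT.
have s3 j : s (4 * j).+3 = b j.
  by rewrite /s -addn3; have [-> ->] := dv j 3%N isT.
have s0 j : s (4 * j)%N = if j == 0%N then V0 else - V j.
  by rewrite /s -[(4 * j)%N]addn0; have [-> ->] := dv j 0%N isT; case: j.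
have s00 : s 0%N = V0 := s0 0%N.
have VS j : V j.+1 - V j = d j by rewrite /V big_ord_recr /=; ring.
exists s => j; rewrite -XE.
have -> : base_coords s = coords n k V W a b.
  apply: eq_coords => i; rewrite ?s1 ?s2 ?s3 ?opprK // /height.
  case: eqP => [->|_]; first by rewrite s00 /V /V0; field.
  case: eqP => [->|/eqP i0]; first by rewrite s00 /V big_ord0 addr0.
  by rewrite s0 (negPf i0) opprK.
suff -> : coords n k V W a b = map X (iota 0 N).
  by rewrite (nth_map 0%N) ?size_iota // nth_iota.
have -> : N = (n.+1 + (k + (k + ((n.+1 - k.*2) + (k + k)))))%N.
  by rewrite size_ed_triangles //; move: k2n; lia.
rewrite !iotaD !map_cat /coords add0n.
congr (_ ++ (_ ++ (_ ++ (_ ++ (_ ++ _))))).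
- apply/eq_in_map => i; rewrite mem_iota add0n ltnS => /andP [_ lin].
  rewrite /a; case: ltnP => ik; last first.
    rewrite ifN; last by rewrite -leqNgt; move: ik; lia.
    by congr X; move: ik; lia.
  case oi: (odd i).
    by rewrite ifT; [congr X; move: oi; lia|move: ik; lia].
  rewrite X0 //; first by rewrite size_ed_triangles //; move: lin; lia.
  by rewrite /degenerate oi /=; apply/orP; left; move: ik; lia.
- by rewrite map_iota_ord; apply: eq_map => i; rewrite /W /B addrK.
- by rewrite map_iota_ord; apply: eq_map => i; rewrite /b addrK.
- have -> : (n.+1 + k + k = n.+1 + k.*2)%N by lia.
  rewrite iotaDl -map_comp; apply/eq_in_map => i; rewrite mem_iota => /andP [ki _].
  rewrite subSn; last by move: ki; lia.
  rewrite VS /d ifN; last by rewrite -leqNgt; move: ki; lia.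
  rewrite addrC addrA addNr add0r /=; congr X; move: ki; lia.
- rewrite map_iota_ord; apply: eq_map => i; have ik := ltn_ord i; rewrite X0 //.
    by rewrite size_ed_triangles //; move: k2n ik; lia.
  by rewrite /degenerate; apply/orP; right; move: k2n ik; lia.
rewrite map_iota_ord; apply: eq_map => i; have ik := ltn_ord i.
have -> : V i.+1 - b i - a i = V i.+1 - V i - (B' i + B i + a i).
  by rewrite /b /W; ring.
rewrite VS /d ik (_ : _ - _ = C i); last by ring.
by rewrite /C; congr X; move: k2n ik; lia.
Qed.

End GenericPoint.

(** * Counting the branches on a generic plane *)

Section Count.
Variables (F : numFieldType) (n k q : nat).
Hypothesis k2n : (k.*2 <= n.+1)%N.
Hypothesis qE : (q + k)%N = n.
Hypothesis q0 : (0 < q)%N.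
Local Notation N := (size (ed_triangles n k)).

Definition block_choice (c : {set 'I_k}) (i : nat) : bool :=
  if insub i is Some l then l \in c else false.

Lemma block_choice_ord c (l : 'I_k) : block_choice c l = (l \in c).
Proof. by rewrite /block_choice valK. Qed.

Lemma block_choice_lt c i : block_choice c i -> (i < k)%N.
Proof. by rewrite /block_choice; case: insubP. Qed.

Lemma sum_block_choice c : (\sum_(i < q.+1) block_choice c i)%N = #|c|.
Proof.
have kq : (k <= q.+1)%N by move: k2n; rewrite -qE; lia.
rewrite -(big_mkord xpredT (fun i => block_choice c i : nat)) (big_cat_nat _ kq) //=.
have -> : (\sum_(k <= i < q.+1) block_choice c i = 0)%N.
  rewrite big_nat big1 // => i /andP [ki _].
  by case E: (block_choice c i) => //; have := block_choice_lt E; rewrite ltnNge ki.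
rewrite addn0.
rewrite big_mkord -sum1_card [RHS]big_mkcond /=.
by apply: eq_bigr => i _; rewrite block_choice_ord; case: (i \in c).
Qed.

(** Each subset is paired with its complement. *)
Lemma sum_card_sets : (2 * \sum_(c : {set 'I_k}) #|c| = k * 2 ^ k)%N.
Proof.
rewrite mul2n -addnn {2}(reindex_inj (@setC_inj _)) -big_split /=.
under eq_bigr => c _ do rewrite cardsC.
by rewrite sum_nat_const card_ord -[#|_|]cardsT -powersetT card_powerset cardsT card_ord mulnC.
Qed.

Variable r : {mpoly F[N]}.
Hypothesis r0 : r != 0.
Hypothesis rJ : forall m (j : 'I_N), m \in msupp r -> degenerate n k j -> m j = 0%N.
Hypothesis rZ : forall t, (forall i, (i < k)%N -> t i = Merged \/ t i = BothOnRay) ->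
  vanishes_on r (drawn t).

Let good s := r.@[fun j : 'I_N => (base_coords n k q s)`_j] != 0.

Lemma generic_good : exists2 s, good s & generic block_choice (4 * q.+1) s.
Proof.
have [x rx] := mpoly_nonroot r0.
pose x' (j : 'I_N) := if degenerate n k j then 0 else x j.
have [s sx] : exists s, forall j : 'I_N, (base_coords n k q s)`_j = x' j.
  by apply: base_coords_onto => // j; rewrite /x' => ->.
apply: (@generic_exists _ _ good _ _ s); last first.
  rewrite /good (meval_eq _ sx) (@meval_indep _ _ r (fun j : 'I_N => degenerate n k j) _ x) //.
  by move=> j /negPf; rewrite /x' => ->.
move=> {x rx x' sx} {}s i L gs.
pose sX l : {poly F} := if l == i then 'X else (s l)%:P.
pose P : {poly F} := mmap polyC (fun j : 'I_N => (base_coords n k q sX)`_j) r.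
have PE t : P.[t] =
    r.@[fun j : 'I_N => (base_coords n k q (fun l => if l == i then t else s l))`_j].
  apply: (@rmorph_mmap _ _ _ _ (horner_eval t)) => [a|j]; first exact: hornerC.
  apply/esym/base_coords_morph => l; rewrite /sX /= /horner_eval.
  by case: ifP; rewrite ?hornerX ?hornerC.
have P0 : P != 0.
  suff : P.[s i] != 0 by apply: contraNneq => ->; rewrite horner0.
  rewrite PE; congr (_ != 0): gs; apply: meval_eq => j.
  apply: (@base_coords_morph _ _ _ F F idfun (fun l => if l == i then s i else s l)) => l /=.
  by case: eqP => // ->.
(* [P] is [r] as a function of the [i]th scalar alone; the product keeps the new value off [L]. *)
have /poly_nonroot [t] : P * \prod_(l <- L) ('X - l%:P) != 0.
  rewrite mulf_neq0 // prodf_seq_neq0; apply/allP => l _.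
  by rewrite -size_poly_gt0 size_XsubC.
rewrite hornerM mulf_eq0 negb_or PE => /andP [rt Lt]; exists t => //.
by apply: contra Lt => tL; rewrite -[_ == 0]/(root _ t) root_prod_XsubC.
Qed.

Section Pencil.
Variable s : nat -> F.
Hypothesis gs : good s.
Hypothesis gen : generic block_choice (4 * q.+1) s.

(** The inner polynomial variable is tau, the outer one is y. *)
Definition pencil : seq {poly {poly F}} :=
  coords n k (height q.+1 (- s 0%N)%:P%:P (fun j => (linV s j)%:P))
    (fun j => (linW s j)%:P)
    (fun j => (s (4 * j).+2)%:P%:P + (if j == q then 'X else 0))
    (fun j => (s (4 * j).+3)%:P%:P + (if j == q then 'X else 0)).

Let f : {poly {poly F}} := mmap (polyC \o polyC) (fun j : 'I_N => pencil`_j) r.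

Lemma eval2_pencil t y : eval2 f t y = r.@[fun j : 'I_N => (coords n k
  (height q.+1 (- s 0%N) (fun j => (linV s j).[t])) (fun j => (linW s j).[t])
  (fun j => s (4 * j).+2 + (if j == q then y else 0))
  (fun j => s (4 * j).+3 + (if j == q then y else 0)))`_j].
Proof.
pose ev : {rmorphism {poly {poly F}} -> F} := horner_eval y \o map_poly (horner_eval t).
have evC p : ev p%:P = p.[t] by rewrite -(eval2C p t y).
have evX : ev 'X = y by rewrite -[RHS](eval2X t y).
apply: (@rmorph_mmap _ _ _ _ ev) => [a|j]; first by rewrite evC hornerC.
rewrite -coords_morph; congr nth; apply: eq_coords => l.
- by rewrite /height; case: ifP => _; rewrite evC ?hornerC.
- by rewrite evC.
- by rewrite rmorphD evC hornerC; case: ifP => _; rewrite ?evX ?rmorph0.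
- by rewrite rmorphD evC hornerC; case: ifP => _; rewrite ?evX ?rmorph0.
Qed.

Lemma pencil_neq0 : f != 0.
Proof.
suff : eval2 f 0 0 != 0.
  by apply: contraNneq => ->; rewrite /eval2 rmorph0 horner0.
rewrite eval2_pencil; congr (_ != 0): gs; apply: meval_eq => j; congr nth.
apply: eq_coords => l.
- rewrite /height; case: ifP => // _; rewrite /linV; case: ifP => _.
    by rewrite hornerC.
  by rewrite hornerXsubC sub0r.
- by rewrite /linW hornerXsubC sub0r.
- by rewrite if_same addr0.
- by rewrite if_same addr0.
Qed.

Lemma pencil_bidegree j : bidegree_le 1 pencil`_j.
Proof.
have bC (p : {poly F}) : (size p <= 2)%N -> bidegree_le 1 p%:P.
  by move=> p2 [|l]; rewrite coefC ?size_poly0.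
have b0 : bidegree_le 1 (0 : {poly {poly F}}) by move=> l; rewrite coef0 size_poly0.
have bX : bidegree_le 1 ('X : {poly {poly F}}).
  by move=> [|[|l]]; rewrite coefX ?size_poly0 ?size_poly1.
have bN (p : {poly {poly F}}) : bidegree_le 1 p -> bidegree_le 1 (- p).
  by move=> bp l; rewrite coefN size_polyN.
have bB (p p' : {poly {poly F}}) : bidegree_le 1 p -> bidegree_le 1 p' -> bidegree_le 1 (p - p').
  by move=> bp bp'; apply: bidegree_leD => //; apply: bN.
have bV l : bidegree_le 1 (height q.+1 (- s 0%N)%:P%:P (fun j => (linV s j)%:P) l).
  rewrite /height; case: ifP => _; apply: bC; rewrite ?size_polyC; first by case: (_ == _).
  by rewrite /linV; case: ifP => _; rewrite ?size_XsubC // size_polyC; case: (_ == _).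
have bW l : bidegree_le 1 (linW s l)%:P by apply: bC; rewrite size_XsubC.
have bs (x : F) (l : nat) : bidegree_le 1 (x%:P%:P + (if l == q then 'X else 0)).
  apply: bidegree_leD; last by case: ifP.
  by apply: bC; rewrite size_polyC; case: (_ == _).
have [js|js] := ltnP j (size pencil); last by rewrite nth_default.
have : pencil`_j \in pencil by apply: mem_nth.
rewrite !mem_cat => /orP [/mapP [i _ ->]|]; first by repeat first [exact: b0|exact: bs|case: ifP => _].
case/orP => [/mapP [i _ ->]|]; first exact: (bB _ _ (bW i) (bV i)).
case/orP => [/mapP [i _ ->]|]; first exact: (bB _ _ (bs _ i) (bW i)).
case/orP => [/mapP [i _ ->]|].
  exact: (bB _ _ (bB _ _ (bV _) (bV _)) (bs _ (i - k)%N)).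
case/orP => [/mapP [i _ ->]|/mapP [i _ ->]]; first exact: b0.
exact: (bB _ _ (bB _ _ (bV _) (bs _ i)) (bs _ i)).
Qed.

(** The branch of a subset [c] contributes q + |c|; the sum over all subsets is 2^k q + k 2^(k-1),
    doubled here to stay in the integers. *)
Lemma pencil_count : (2 ^ k * (2 * q + k) <= 2 * (msize r).-1)%N.
Proof.
have H := @bidegree_generic_roots F _ (enum {set 'I_k})
  (fun c => root_num s q (block_choice c)) (fun c => root_den s q (block_choice c))
  (msize r).-1 f (enum_uniq _) pencil_neq0 (bidegree_le_mmap r (fun j : 'I_N => pencil_bidegree j)).
have {H} : (\sum_(c : {set 'I_k}) size (root_den s q (block_choice c)) <= (msize r).-1)%N.
  rewrite -big_enum; apply: H => [c _|c1 c2 _ _ c12]; last first.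
    have [l lc] : exists l, (l \in c1) != (l \in c2).
      apply/existsP; apply: contraNT c12 => /existsPn H; apply/eqP/setP => l.
      by have /negPn/eqP := H l.
    have lq : (l < q.+1)%N by move: k2n (ltn_ord l); rewrite -qE; lia.
    move: lc; rewrite -!block_choice_ord.
    case l1: (block_choice c1 l); case l2: (block_choice c2 l) => // _.
      by apply: (root_den_separated q0 gen lq); rewrite ?l1 ?l2.
    by rewrite eq_sym; apply: (root_den_separated q0 gen lq); rewrite ?l1 ?l2.
  split; first exact: coprimep_root_num_den.
    exact: (root_den_neq0 gen).
  exists (nondegeneracy s q (block_choice c)); first exact: (nondegeneracy_neq0 q0 gen).
  move=> t nt dt; rewrite eval2_pencil.
  apply: (rZ (t := fun j => if block_choice c j then BothOnRay else Merged)).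
    by move=> i ik; case: ifP => _; [right|left].
  apply: drawn_root => //; first exact: block_choice_lt.
  exact: (s0_neq0 gen).
under eq_bigr => c _ do rewrite (size_root_den q0 gen) sum_block_choice.
rewrite big_split /= sum_nat_const -[#|_|]cardsT -powersetT card_powerset cardsT card_ord.
have := sum_card_sets; move: (\sum_(c : {set 'I_k}) _)%N (2 ^ k)%N => S K.
move=> HS le; rewrite mulnDr mulnCA [(K * k)%N]mulnC -HS -mulnDr leq_mul2l.
exact: le.
Qed.
End Pencil.
End Count.

(** * The Monsky polynomial *)

Section Bridge.
Variable R : realType.
Local Notation C := R[i].

Lemma det2 (A : comNzRingType) (M : 'M[A]_2) :
  \det M = M 0 0 * M 1 1 - M 0 1 * M 1 0.
Proof.
rewrite (expand_det_row _ 0) !big_ord_recl big_ord0 /cofactor !det_mx11 !mxE /=.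
rewrite !expr0 !expr1 addr0 mul1r mulrA mulrN1 mulNr.
by congr (_ * M _ _ - M _ _ * M _ _); apply/val_inj.
Qed.

Lemma signed_areaE (a b c : 'cV[C]_2) : signed_area a b c =
  ((b 0 0 - a 0 0) * (c 1 0 - a 1 0) - (c 0 0 - a 0 0) * (b 1 0 - a 1 0)) / 2.
Proof.
rewrite /signed_area; congr (_ / 2).
rewrite (expand_det_row _ 0) !big_ord_recl big_ord0 /cofactor !det2 !mxE.
rewrite !(tnth_nth 0) /=.
ring.
Qed.

Section Frame.
Variables (n k : nat) (z : 4.-tuple 'cV[C]_2) (hz : nondegenerate_parallelogram z).
Variable rho : bool -> ed_vertex n k -> C.
Hypothesis fr : framed rho.

(* Doubling the abscissas compensates the factor 1/2 in [signed_area]. *)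
Definition plane_drawing (v : ed_vertex n k) : 'cV[C]_2 :=
  \col_i (if i == 0 then 2 * rho false v else rho true v).

Lemma area_vector_plane_drawing :
  area_vector (T := exploded_diagonal n k) plane_drawing =1
  fun j : 'I_(size (ed_triangles n k)) => (areas rho)`_j.
Proof.
move=> j; pose t0 := tnth (in_tuple (ed_triangles n k)) j.
rewrite /areas (nth_map t0) // /area_vector (tnth_nth t0) /=.
rewrite signed_areaE !mxE /= /cross.
by field.
Qed.

Lemma plane_drawing_drawing : drawing (T := exploded_diagonal n k) z plane_drawing.
Proof.
have [par det0] := hz.
pose Z : 'M_(2, 1 + 1) := row_mx (tnth z 1 - tnth z 0) (tnth z 3 - tnth z 0).
pose D v := plane_drawing v - plane_drawing (vp ord0).
(* The linear part is determined by the two edges at P; the image of the opposite corner is then R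
   because P + R = Q and S = 0. *)
pose A := row_mx (D vQ) (D vS) *m invmx (Z : 'M_2).
have AZ : A *m Z = row_mx (D vQ) (D vS).
  by rewrite /A mulmxKV // unitmxE unitfE.
move: AZ; rewrite mul_mx_row => /eq_row_mx [A1 A3].
exists A, (plane_drawing (vp ord0) - A *m tnth z 0) => i.
have E (v : 'cV[C]_2) : A *m v + (plane_drawing (vp ord0) - A *m tnth z 0)
    = plane_drawing (vp ord0) + A *m (v - tnth z 0).
  by rewrite mulmxBr addrCA addrA.
rewrite E; case: i => [[|[|[|[|//]]]] i4].
- rewrite (tnth_nth vS) /= (_ : Ordinal i4 = 0); last exact: val_inj.
  by rewrite subrr mulmx0 addr0.
- rewrite (tnth_nth vS) /= (_ : Ordinal i4 = 1); last exact: val_inj.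
  by rewrite A1 /D addrC subrK.
- rewrite (tnth_nth vS) /= (_ : Ordinal i4 = 2); last exact: val_inj.
  have -> : tnth z 2 - tnth z 0 = (tnth z 1 - tnth z 0) + (tnth z 3 - tnth z 0).
    by rewrite par addrC addrA subrK addrC.
  rewrite mulmxDr A1 A3 /D; apply/colP => d; rewrite !mxE.
  have [S0 PR] := fr false; have [S1 PR1] := fr true.
  by case: ifP => _; rewrite ?S0 ?S1 -?PR -?PR1; ring.
- rewrite (tnth_nth vS) /= (_ : Ordinal i4 = 3); last exact: val_inj.
  by rewrite A3 /D addrC subrK.
Qed.
End Frame.

Lemma irreducible_msize N (p : {mpoly C[N]}) : irreducible_mpoly p -> (1 < msize p)%N.
Proof.
case=> p0 pu _; rewrite ltnNge; apply: contra pu => p1.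
have [c c0 ->] : exists2 c, c != 0 & p = c%:MP.
  exists p@_0; last exact: msize1_polyC.
  by rewrite -(mpolyC_eq0 N) -msize1_polyC.
by apply/unitrP; exists (c^-1)%:MP; rewrite -!mpolyCM mulVf // mulfV.
Qed.

Lemma meval0_homog N d (p : {mpoly C[N]}) :
  p \is d.-homog -> (0 < d)%N -> p.@[fun=> 0] = 0.
Proof.
move=> /dhomogP pd d0; rewrite mevalE big_seq big1 // => m mp.
have : mdeg m != 0%N by rewrite (pd m mp) -lt0n.
rewrite mdegE sum_nat_eq0 negb_forall => /existsP [i /= mi].
by rewrite (bigD1 i) //= expr0n (negPf mi) mul0r mulr0.
Qed.

Lemma monsky_vanishes n k (z : 4.-tuple 'cV[C]_2)
    (p : {mpoly int[size (triangles (exploded_diagonal n k))]}) :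
    nondegenerate_parallelogram z -> monsky_polynomial z p ->
  vanishes_on (map_mpoly intr p : {mpoly C[_]}) (drawn (n := n) (k := k) (fun=> Free)).
Proof.
move=> hz [_ [d pd] pirr pV] x [rho [_ [_ [[fr _] xE]]]].
have p1 := irreducible_msize pirr.
case: (pickP (fun j => x j != 0)) => [j xj|x0].
  apply: pV; split; first by exists j.
  move=> e f _ fS; apply: fS; split; first by exists j.
  exists (plane_drawing rho); first exact: plane_drawing_drawing.
  apply: boolp.funext => i; rewrite xE; exact/esym/area_vector_plane_drawing.
(* The zero vector is no projective point; there [p] vanishes by homogeneity, its degree being
   positive. *)
rewrite (meval_eq _ (v2 := fun=> 0)); last by move=> j; apply/eqP/negPn; rewrite x0.
have pdC : (map_mpoly intr p : {mpoly C[_]}) \is d.-homog.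
  move/dhomogP: pd => pd; apply/dhomogP => m.
  by rewrite mcoeff_msupp mcoeff_map_mpoly => /= m0; apply: pd; rewrite mcoeff_msupp;
    apply: contraNneq m0 => ->.
apply: (meval0_homog pdC); rewrite lt0n; apply: contraTneq p1 => d0.
rewrite -leqNgt msizeE; apply/bigmax_leqP_seq => m mp _.
by move/dhomogP: pdC => /(_ m mp) ->; rewrite d0.
Qed.

Lemma msize_map_intr N (p : {mpoly int[N]}) :
  (msize (map_mpoly intr p : {mpoly C[N]}) <= msize p)%N.
Proof.
rewrite [X in (X <= _)%N]msizeE; apply/bigmax_leqP_seq => m + _.
rewrite mcoeff_msupp mcoeff_map_mpoly /= => m0; apply: msize_mdeg_lt.
by rewrite mcoeff_msupp; apply: contraNneq m0 => ->.
Qed.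

End Bridge.

Theorem theorem26 (R : realType) (n k : nat)
    (hk : k%:R <= (n%:R + 1) / 2 :> rat)
    (z : 4.-tuple 'cV[R[i]]_2) (hz : nondegenerate_parallelogram z)
    (p : {mpoly int[size (triangles (exploded_diagonal n k))]})
    (hp : monsky_polynomial z p) :
  2 ^ (k%:Z - 1) * (2 * n%:R - k%:R) <= (total_degree p)%:R :> rat.
Proof.
have k2n : (k.*2 <= n.+1)%N.
  by move: hk; rewrite ler_pdivlMr // natr1 -natrM ler_nat muln2.
have [_ _ pirr _] := hp; have pC1 := irreducible_msize pirr.
have pszC := msize_map_intr R p; rewrite /total_degree.
have td1 : (1 <= (msize p).-1)%N by move: (leq_trans pC1 pszC); case: (msize p).
(* Doubling clears 2^(k-1), whose exponent is negative for k = 0. *)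
suff nat_bound : (2 ^ k * (2 * n - k) <= 2 * (msize p).-1)%N.
  have -> : 2 ^ (k%:Z - 1) * (2 * n%:R - k%:R) = 2 ^+ k * (2 * n%:R - k%:R) / 2 :> rat.
    by rewrite expfzDr // exprN1 -exprnP; ring.
  rewrite ler_pdivrMr //; move: nat_bound; rewrite -(ler_nat rat) !natrM natrX.
  rewrite natrB ?natrM; last by move: k2n; lia.
  by rewrite [(_.-1)%:R * _]mulrC.
have [q0|q0] := posnP (n - k)%N.
  (* Only n = k <= 1 is possible here, and the bound is then at most 1. *)
  have nk : n = k by move: k2n q0; lia.
  have k1 : (k <= 1)%N by move: k2n; lia.
  move: td1; move: (msize p).-1 => M M1; rewrite nk.
  have [->|->] : k = 0%N \/ k = 1%N by move: k1; lia.
    by [].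
  by rewrite expn1; move: M1; lia.
have pC0 : (map_mpoly intr p : {mpoly (R[i])[_]}) != 0 by case: pirr.
have [r [r0 szr rJ rZ]] := specialize_areas k2n pC0 (monsky_vanishes hz hp).
have qE : (n - k + k)%N = n by rewrite subnK //; move: k2n; lia.
have [s gs gen] := generic_good k2n qE r0 rJ.
have := pencil_count k2n qE q0 r0 rZ gs gen.
have -> : (2 * (n - k) + k = 2 * n - k)%N by move: k2n; lia.
move=> H; apply: leq_trans H _; rewrite leq_mul2l /=.
by rewrite -!subn1 leq_sub2r // (leq_trans szr pszC).
Qed.
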